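(* Let $\lambda\in(0,1]$. For all terms $t,s\in\mathbb T$ and all $\varepsilon\in\mathbb Q_{\ge0}$: if $\mathbf d^\lambda(t,s)\le\varepsilon$, then $\vdash_\lambda t\equiv_\varepsilon s$ (derivable from the empty set of hypotheses).
   Context: Fix a countable set $\mathcal L$ of labels and a countable set $\mathcal X$ of names. $\mathcal D(S)$ is the set of finitely supported sub-probability distributions on $S$; $\mu(E)=\sum_{x\in E}\mu(x)$; $\mathbb 1_E$ is the indicator function of $E$. Terms: given a set $V$ of constants, $\mathbb T(V)$ is the set of terms generated by: each $v\in V$ and each name $X\in\mathcal X$ is a term; if $t,s$ are terms, $a\in\mathcal L$, $e\in[0,1]$, $X\in\mathcal X$, then $a.t$, $t+_es$, $\mu X.t$ are terms ($\mu X$ binds $X$; terms identified up to renaming of bound names; $t[s/X]$ is capture-avoiding substitution). $\mathbb T=\mathbb T(\emptyset)$. A name $X$ is guarded in $t$ if every free occurrence of $X$ lies inside a subterm $a.u$, or inside the right argument $u$ of a subterm $s+_1u$, or inside the left argument $u$ of a subterm $u+_0s$. Universal chain: $\tau_{\mathbb T}$ is the least function $\mathbb T\to[(\mathcal L\times\mathbb T)\uplus\mathcal X\to[0,1]]$ (pointwise order) with $\tau_{\mathbb T}(X)=\mathbb 1_{\{X\}}$, $\tau_{\mathbb T}(a.t)=\mathbb 1_{\{(a,t)\}}$, $\tau_{\mathbb T}(t+_es)=e\tau_{\mathbb T}(t)+(1-e)\tau_{\mathbb T}(s)$, $\tau_{\mathbb T}(\mu X.t)=\tau_{\mathbb T}(t[\mu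 X.t/X])$; each $\tau_{\mathbb T}(t)\in\mathcal D((\mathcal L\times\mathbb T)\uplus\mathcal X)$. Discounted distance: for a set $A$ with $1$-bounded pseudometric $\delta$ and finitely supported probability distributions $\mu,\nu$ on $A$, $K_\delta(\mu,\nu)=\min\{\sum_{x,y}\delta(x,y)\omega(x,y):\omega\text{ a coupling of }\mu,\nu\}$; for a sub-probability $\mu$, $\mu^*$ extends it to $A\uplus\{\bot\}$ with $\mu^*(\bot)=1-\mu(A)$. For a $1$-bounded pseudometric $d$ on $\mathbb T$, $\Lambda^\lambda(d)$ is the greatest $1$-bounded pseudometric on $((\mathcal L\times\mathbb T)\uplus\mathcal X)\uplus\{\bot\}$ with $\Lambda^\lambda(d)((a,t),(a,s))=\lambda\cdot d(t,s)$; $\Psi^\lambda(d)(t,s)=K_{\Lambda^\lambda(d)}(\tau_{\mathbb T}(t)^*,\tau_{\mathbb T}(s)^* )$; $\mathbf d^\lambda$ is the least fixed point of $\Psi^\lambda$ among $1$-bounded pseudometrics on $\mathbb T$ ordered pointwise. Deduction system: let $W$ be a countable set of metavariables. A quantitative equation is $t\equiv_\varepsilon s$ with $t,s\in\mathbb T(W)$, $\varepsilon\in\mathbb Q_{\ge0}$. A substitution $\sigma$ maps metavariables to terms of $\mathbb T(W)$, extended homomorphically. $\vdash_\lambda$ is the smallest relation between sets of quantitative equations and quantitative equations (write $\Gamma\vdash_\lambda\varphi$; $\vdash_\lambda\varphi$ for $\emptyset\vdash_\lambda\varphi$; $\Gamma\vdash_\lambda\Theta$ means $\Gamma\vdash_\lambda\varphi$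 for all $\varphi\in\Theta$) satisfying, for all terms $t,s,u,t',s'$ of $\mathbb T(W)$, names $X$, labels $a$, $e\in[0,1]$, rationals $\varepsilon,\varepsilon'\ge0$ (with $\vdash$ read as $\vdash_\lambda$): (Refl) $\vdash t\equiv_0t$; (Symm) $\{t\equiv_\varepsilon s\}\vdash s\equiv_\varepsilon t$; (Triang) $\{t\equiv_\varepsilon u,u\equiv_{\varepsilon'}s\}\vdash t\equiv_{\varepsilon+\varepsilon'}s$; (Max) $\{t\equiv_\varepsilon s\}\vdash t\equiv_{\varepsilon+\varepsilon'}s$ for $\varepsilon'>0$; (Arch) $\{t\equiv_{\varepsilon'}s\mid\varepsilon'>\varepsilon\}\vdash t\equiv_\varepsilon s$; (Subst) if $\Gamma\vdash t\equiv_\varepsilon s$ then $\sigma(\Gamma)\vdash\sigma(t)\equiv_\varepsilon\sigma(s)$; (Cut) if $\Gamma\vdash\Theta$ and $\Theta\vdash t\equiv_\varepsilon s$ then $\Gamma\vdash t\equiv_\varepsilon s$; (Assum) if $t\equiv_\varepsilon s\in\Gamma$ then $\Gamma\vdash t\equiv_\varepsilon s$; (B1) $\vdash t+_1s\equiv_0t$; (B2) $\vdash t+_et\equiv_0t$; (SC) $\vdash t+_es\equiv_0s+_{1-e}t$; (SA) $\vdash(t+_es)+_{e'}u\equiv_0t+_{ee'}(s+_{\frac{e'-ee'}{1-ee'}}u)$ for $e,e'\in[0,1)$; (Unfold) $\vdash\mu X.t\equiv_0t[\mu X.t/X]$; (Unguard) $\vdash\mu X.(t+_eX)\equiv_0\mu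 X.t$; (Fix) $\{s\equiv_0t[s/X]\}\vdash s\equiv_0\mu X.t$ when $X$ is guarded in $t$; (Cong) $\{t\equiv_0s\}\vdash\mu X.t\equiv_0\mu X.s$; (Top) $\vdash t\equiv_1s$; (Pref) $\{t\equiv_\varepsilon s\}\vdash a.t\equiv_\varepsilon a.s$; (IB) $\{t\equiv_\varepsilon s,t'\equiv_{\varepsilon'}s'\}\vdash t+_et'\equiv_{\varepsilon''}s+_es'$ for every rational $\varepsilon''\ge e\varepsilon+(1-e)\varepsilon'$; ($\lambda$-Pref) $\{t\equiv_\varepsilon s\}\vdash a.t\equiv_{\varepsilon'}a.s$ for every rational $\varepsilon'\ge\lambda\varepsilon$. *)

(* Defs.v *)
From HB Require Import structures.
From mathcomp Require Import all_boot all_order all_algebra.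
From mathcomp Require Import interval_inference.
From mathcomp Require Import boolp classical_sets functions cardinality fsbigop.
From mathcomp Require Import reals.

Set Implicit Arguments.
Unset Strict Implicit.
Unset Printing Implicit Defensive.
Import Order.TTheory GRing.Theory Num.Theory.
Local Open Scope classical_set_scope.
Local Open Scope ring_scope.

(* Terms up to renaming of bound names, as a nested datatype: [term R L V N]
   has constants in [V] and free names in [N]; in [Rec b] the name bound by the
   recursion operator is [None], a free name [X] of [Rec b] is [Some X] in [b].
   [Sum e t s] is the probabilistic choice t +_e s.  The recursion mu X.t with
   an explicitly named bound variable is [mu X t] below. *)
Inductive term (R : realType) (L V N : Type) : Type :=
| Cst of V
| Var of N
| Pre of L & term R L V N
| Sum of {i01 R} & term R L V N & term R L V N
| Rec of term R L V (option N).

Arguments Cst {R L V N} v.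
Arguments Var {R L V N} X.
Arguments Pre {R L V N} a t.
Arguments Sum {R L V N} e t s.
Arguments Rec {R L V N} b.

HB.instance Definition _ (R : realType) (L V N : Type) :=
  gen_eqMixin (term R L V N).
HB.instance Definition _ (R : realType) (L V N : Type) :=
  gen_choiceMixin (term R L V N).

Fixpoint ren (R : realType) (L V N N' : Type) (f : N -> N')
    (t : term R L V N) : term R L V N' :=
  match t with
  | Cst v => Cst v
  | Var X => Var (f X)
  | Pre a u => Pre a (ren f u)
  | Sum e u u' => Sum e (ren f u) (ren f u')
  | Rec b => Rec (ren (omap f) b)
  end.

(* Simultaneous capture-avoiding substitution: terms entering the scope of a
   binder have their free names shifted by [ren Some]. *)
Fixpoint tsubst (R : realType) (L V V' N N' : Type)
    (c : V -> term R L V' N') (f : N -> term R L V' N')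
    (t : term R L V N) : term R L V' N' :=
  match t with
  | Cst v => c v
  | Var X => f X
  | Pre a u => Pre a (tsubst c f u)
  | Sum e u u' => Sum e (tsubst c f u) (tsubst c f u')
  | Rec b =>
      Rec (tsubst (fun v => ren Some (c v))
                  (fun o => if o is Some X then ren Some (f X)
                            else Var None) b)
  end.

(* t[s/X] *)
Definition nsubst (R : realType) (L V : Type) (N : eqType) (t : term R L V N)
    (X : N) (s : term R L V N) : term R L V N :=
  tsubst Cst (fun Y => if Y == X then s else Var Y) t.

(* mu X.t *)
Definition mu (R : realType) (L V : Type) (N : eqType) (X : N)
    (t : term R L V N) : term R L V N :=
  Rec (ren (fun Y => if Y == X then None else Some Y) t).

Definition csubst (R : realType) (L V V' N : Type) (c : V -> term R L V' N)
    (t : term R L V N) : term R L V' N :=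
  tsubst c Var t.

Definition embed (R : realType) (L W N : Type) (t : term R L void N) :
    term R L W N :=
  csubst (fun v : void => match v with end) t.

Fixpoint guarded (R : realType) (L V N : Type) (X : N) (t : term R L V N) :
    Prop :=
  match t with
  | Cst _ => True
  | Var Y => Y <> X
  | Pre _ _ => True
  | Sum e u u' =>
      (e%:num = 0 \/ guarded X u) /\ (e%:num = 1 \/ guarded X u')
  | Rec b => guarded (Some X) b
  end.

(* The pointwise least / greatest function satisfying [P]; the value is [0] if
   there is none. *)
Definition least_fun (R : realType) (A B : Type) (P : set (A -> B -> R)) :
    A -> B -> R :=
  xget (fun _ _ => 0)
    [set f | P f /\ forall g, P g -> forall x y, f x y <= g x y].

Definition greatest_fun (R : realType) (A B : Type) (P : set (A -> B -> R)) :
    A -> B -> R :=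
  xget (fun _ _ => 0)
    [set f | P f /\ forall g, P g -> forall x y, g x y <= f x y].

Definition succ (R : realType) (L N : Type) : Type :=
  (L * term R L void N + N)%type.

Definition chain_eqs (R : realType) (L N : choiceType) :
    set (term R L void N -> succ R L N -> R) :=
  [set tau |
    (forall t x, 0 <= tau t x <= 1) /\
    (forall X x, tau (Var X) x = (x == inr X)%:R) /\
    (forall a t x, tau (Pre a t) x = (x == inl (a, t))%:R) /\
    (forall e t s x,
       tau (Sum e t s) x = e%:num * tau t x + (1 - e%:num) * tau s x) /\
    (forall X t, tau (mu X t) = tau (nsubst t X (mu X t)))].

Definition universal_chain (R : realType) (L N : choiceType) :
    term R L void N -> succ R L N -> R :=
  least_fun (@chain_eqs R L N).

Definition pseudometric1 (R : realType) (A : Type) (d : A -> A -> R) : Prop :=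
  (forall x y, 0 <= d x y <= 1) /\
  (forall x, d x x = 0) /\
  (forall x y, d x y = d y x) /\
  (forall x y z, d x z <= d x y + d y z).

Definition coupling (R : realType) (A : choiceType) (m n : A -> R)
    (w : A * A -> R) : Prop :=
  (forall p, 0 <= w p) /\
  finite_set [set p | w p != 0] /\
  (forall x, \sum_(y \in [set: A]) w (x, y) = m x) /\
  (forall y, \sum_(x \in [set: A]) w (x, y) = n y).

(* For finitely supported [m] and [n] the couplings form a compact polytope,
   so this infimum is a minimum. *)
Definition kantorovich (R : realType) (A : choiceType) (d : A -> A -> R)
    (m n : A -> R) : R :=
  inf [set \sum_(p \in [set: A * A]) d p.1 p.2 * w p | w in coupling m n].

Definition star (R : realType) (A : choiceType) (m : A -> R) (o : option A) :
    R :=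
  if o is Some x then m x else 1 - \sum_(x \in [set: A]) m x.

Definition Lam (R : realType) (L N : choiceType) (lambda : R)
    (d : term R L void N -> term R L void N -> R) :
    option (succ R L N) -> option (succ R L N) -> R :=
  greatest_fun [set D | pseudometric1 D /\
    forall a t s, D (Some (inl (a, t))) (Some (inl (a, s))) = lambda * d t s].

Definition Psi (R : realType) (L N : choiceType) (lambda : R)
    (d : term R L void N -> term R L void N -> R)
    (t s : term R L void N) : R :=
  kantorovich (Lam lambda d) (star (universal_chain t))
                             (star (universal_chain s)).

Definition discounted_dist (R : realType) (L N : choiceType) (lambda : R) :
    term R L void N -> term R L void N -> R :=
  least_fun [set d | pseudometric1 d /\ Psi lambda d = d].

Record qeq (R : realType) (L W N : Type) : Type :=
  Qeq { lhs : term R L W N; tol : {nonneg rat}; rhs : term R L W N }.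

Notation "t ≡[ e ] s" := (Qeq t e s) (at level 70, e at level 50).

Definition qsubst (R : realType) (L W N : Type) (sigma : W -> term R L W N)
    (q : qeq R L W N) : qeq R L W N :=
  csubst sigma (lhs q) ≡[tol q] csubst sigma (rhs q).

Inductive derivable (R : realType) (L W N : choiceType) (lambda : R) :
    set (qeq R L W N) -> qeq R L W N -> Prop :=
| Refl t : derivable lambda set0 (t ≡[0%:nng] t)
| Symm t s eps : derivable lambda [set t ≡[eps] s] (s ≡[eps] t)
| Triang t s u eps eps' :
    derivable lambda [set t ≡[eps] u; u ≡[eps'] s]
      (t ≡[(eps%:num + eps'%:num)%:nng] s)
| Max t s eps (eps' : {nonneg rat}) : 0 < eps'%:num ->
    derivable lambda [set t ≡[eps] s] (t ≡[(eps%:num + eps'%:num)%:nng] s)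
| Arch t s (eps : {nonneg rat}) :
    derivable lambda
      [set t ≡[eps'] s | eps' in [set eps' : {nonneg rat} |
                                    eps%:num < eps'%:num]]
      (t ≡[eps] s)
| Subst sigma G q :
    derivable lambda G q ->
    derivable lambda [set qsubst sigma g | g in G] (qsubst sigma q)
| Cut G T q :
    (forall p, T p -> derivable lambda G p) ->
    derivable lambda T q -> derivable lambda G q
| Assum (G : set (qeq R L W N)) q : G q -> derivable lambda G q
| B1 t s (e : {i01 R}) : e%:num = 1 ->
    derivable lambda set0 (Sum e t s ≡[0%:nng] t)
| B2 t e : derivable lambda set0 (Sum e t t ≡[0%:nng] t)
| SC t s e :
    derivable lambda set0 (Sum e t s ≡[0%:nng] Sum (1 - e%:num)%:i01 s t)
| SA t s u (e e' f : {i01 R}) : e%:num < 1 -> e'%:num < 1 ->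
    f%:num = (e'%:num - e%:num * e'%:num) / (1 - e%:num * e'%:num) ->
    derivable lambda set0
      (Sum e' (Sum e t s) u ≡[0%:nng] Sum (e%:num * e'%:num)%:i01 t (Sum f s u))
| Unfold X t : derivable lambda set0 (mu X t ≡[0%:nng] nsubst t X (mu X t))
| Unguard X t e : derivable lambda set0 (mu X (Sum e t (Var X)) ≡[0%:nng] mu X t)
| Fix X t s : guarded X t ->
    derivable lambda [set s ≡[0%:nng] nsubst t X s] (s ≡[0%:nng] mu X t)
| Cong X t s :
    derivable lambda [set t ≡[0%:nng] s] (mu X t ≡[0%:nng] mu X s)
| Top t s : derivable lambda set0 (t ≡[1%:nng] s)
| Pref a t s eps :
    derivable lambda [set t ≡[eps] s] (Pre a t ≡[eps] Pre a s)
| IB (e : {i01 R}) t s t' s' (eps eps' eps'' : {nonneg rat}) :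
    e%:num * ratr eps%:num + (1 - e%:num) * ratr eps'%:num
      <= ratr eps''%:num ->
    derivable lambda [set t ≡[eps] s; t' ≡[eps'] s']
      (Sum e t t' ≡[eps''] Sum e s s')
| LPref a t s (eps eps' : {nonneg rat}) :
    lambda * ratr eps%:num <= ratr eps'%:num ->
    derivable lambda [set t ≡[eps] s] (Pre a t ≡[eps'] Pre a s).

(* Main.v *)
(* The provable distance D and the behavioural distance d are compared on the
   finite set of terms reachable from t and s.  Every term is provably the convex
   combination of its transitions, so D(t,s) is at most the cost of any coupling
   of the transitions of t and s, for the lifting of D; and d is a fixed point of
   Psi.  If m = max (D - d) were positive, then a nearly optimal coupling for d at
   a pair attaining m would put almost all its mass on pairs attaining m, so that
   the set of these pairs generates a bisimulation.  Guarded systems have provably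
   unique solutions, hence bisimilar terms are provably at distance 0; so D = 0 at
   these pairs, contradicting D - d = m > 0.  Letting the error of the coupling
   tend to 0, no optimal coupling is needed. *)

Require Import Defs.
From mathcomp Require Import all_boot all_order all_algebra.
From mathcomp Require Import interval_inference.
From mathcomp Require Import boolp classical_sets functions cardinality fsbigop.
From mathcomp Require Import reals.
From mathcomp Require Import ring lra.

Set Implicit Arguments.
Unset Strict Implicit.
Unset Printing Implicit Defensive.
Import Order.TTheory GRing.Theory Num.Theory.
Local Open Scope classical_set_scope.
Local Open Scope ring_scope.

(** * Substitution *)

Section Syntax.
Context {R : realType} {L : Type}.
Implicit Types V N : Type.

(** Expanding into transitions gives [D] <= Psi([D]), which only places [D] below the greatest fixed
    point of Psi. For lambda = 1 that one can be strictly larger than [d]: two different unrollings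
    of one loop are at distance 0 for [d] but may stay at distance 1 for the greatest fixed point.
    The uniqueness expressed by (Fix) closes this gap. The number [m'] is nonnegative and bounds all
    values of [D - d] other than [m]. Transitions without a common label contribute a difference of
    0, and discounting cannot increase a positive one, so each pair outside the extremal ones falls
    short of [m] by at least [m - m']; a coupling of excess cost [e * (m - m')] hence gives such
    pairs mass at most [e]. These couplings vary with [e], so there is no single one to read a
    bisimulation from. Instead, integrals of test functions constant along extremal pairs are
    compared: they do not depend on the coupling and differ by at most a multiple of every [e]. *)

Definition bcons {A N} (a : A) (f : N -> A) (o : option N) : A :=
  if o is Some X then f X else a.

Definition inst {V N} (s : term R L V N) : term R L V (option N) -> term R L V N :=
  tsubst Cst (bcons s Var).

Lemma ren_ren V N (t : term R L V N) N' N'' (f : N -> N') (g : N' -> N'') :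
  ren g (ren f t) = ren (g \o f) t.
Proof.
elim: t N' N'' f g => //= {N} [N a t IH|N e t IHt s IHs|N b IH] N' N'' f g.
- by rewrite IH.
- by rewrite IHt IHs.
- by rewrite IH; congr (Rec (ren _ _)); apply/funext => -[].
Qed.

Lemma tsubst_ren V N (t : term R L V N) V' N' N'' (c : V -> term R L V' N'')
    (f : N' -> term R L V' N'') (h : N -> N') :
  tsubst c f (ren h t) = tsubst c (f \o h) t.
Proof.
elim: t V' N' N'' c f h => //= {N} [N a t IH|N e t IHt s IHs|N b IH] V' N' N'' c f h.
- by rewrite IH.
- by rewrite IHt IHs.
- by rewrite IH; congr (Rec (tsubst _ _ _)); apply/funext => -[].
Qed.

Lemma ren_tsubst V N (t : term R L V N) V' N' N'' (c : V -> term R L V' N')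
    (f : N -> term R L V' N') (h : N' -> N'') :
  ren h (tsubst c f t) = tsubst (ren h \o c) (ren h \o f) t.
Proof.
elim: t V' N' N'' c f h => //= {N} [N a t IH|N e t IHt s IHs|N b IH] V' N' N'' c f h.
- by rewrite IH.
- by rewrite IHt IHs.
- rewrite IH; congr (Rec (tsubst _ _ _)).
  + by apply/funext => v /=; rewrite !ren_ren.
  + by apply/funext => -[X|] //=; rewrite !ren_ren.
Qed.

Lemma tsubst_tsubst V N (t : term R L V N) V' V'' N' N''
    (c : V -> term R L V' N') (f : N -> term R L V' N')
    (c' : V' -> term R L V'' N'') (f' : N' -> term R L V'' N'') :
  tsubst c' f' (tsubst c f t) = tsubst (tsubst c' f' \o c) (tsubst c' f' \o f) t.
Proof.
elim: t V' V'' N' N'' c f c' f' => //= {N} [N a t IH|N e t IHt s IHs|N b IH]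
  V' V'' N' N'' c f c' f'.
- by rewrite IH.
- by rewrite IHt IHs.
- rewrite IH; congr (Rec (tsubst _ _ _)).
  + by apply/funext => v /=; rewrite tsubst_ren ren_tsubst.
  + by apply/funext => -[X|] //=; rewrite tsubst_ren ren_tsubst.
Qed.

Lemma ren_subst V N (t : term R L V N) N' (f : N -> N') :
  ren f t = tsubst Cst (Var \o f) t.
Proof.
elim: t N' f => //= {N} [N a t IH|N e t IHt s IHs|N b IH] N' f.
- by rewrite IH.
- by rewrite IHt IHs.
- by rewrite IH; congr (Rec (tsubst _ _ _)); apply/funext => -[].
Qed.

Lemma tsubst_Var V N (t : term R L V N) : tsubst Cst Var t = t.
Proof.
elim: t => //= {N} [N a t IH|N e t IHt s IHs|N b IH].
- by rewrite IH.
- by rewrite IHt IHs.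
- by congr Rec; rewrite -[RHS]IH; congr (tsubst _ _ _); apply/funext => -[].
Qed.

Definition up {V N N'} (f : N -> term R L V N') : option N -> term R L V (option N') :=
  bcons (Var None) (ren Some \o f).

Lemma tsubst_Rec V N N' (f : N -> term R L V N') b :
  tsubst Cst f (Rec b) = Rec (tsubst Cst (up f) b).
Proof. by []. Qed.

Lemma inst_up V N N' (f : N -> term R L V N') s b :
  inst s (tsubst Cst (up f) b) = tsubst Cst (bcons s f) b.
Proof.
rewrite /inst tsubst_tsubst; congr (tsubst _ _ _).
by apply/funext => -[X|] //=; rewrite tsubst_ren tsubst_Var.
Qed.

Lemma tsubst_inst V N N' (f : N -> term R L V N') s b :
  tsubst Cst f (inst s b) = tsubst Cst (bcons (tsubst Cst f s) f) b.
Proof. by rewrite /inst tsubst_tsubst; congr (tsubst _ _ _); apply/funext => -[]. Qed.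

Lemma inst_ren_Some V N (s t : term R L V N) : inst s (ren Some t) = t.
Proof. by rewrite /inst tsubst_ren tsubst_Var. Qed.

Fixpoint occ V N (X : N) (t : term R L V N) : Prop :=
  match t with
  | Cst _ => False
  | Var Y => Y = X
  | Pre _ u => occ X u
  | Sum _ u u' => occ X u \/ occ X u'
  | Rec b => occ (Some X) b
  end.

Lemma occ_ren V N (t : term R L V N) N' (f : N -> N') X :
  occ X (ren f t) <-> exists2 Y, occ Y t & f Y = X.
Proof.
elim: t N' f X => /= {N} [N v|N Y|N a t IH|N e t IHt s IHs|N b IH] N' f X.
- by split => // -[].
- by split => [<-|[_ <-]//]; exists Y.
- exact: IH.
- rewrite IHt IHs; split => [[][Y Yo <-]|[Y [Yo|Yo] <-]]; try by exists Y; auto.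
  + by left; exists Y.
  + by right; exists Y.
- rewrite IH; split => [[[Y|] Yo //= [<-]]|[Y Yo <-]]; first by exists Y.
  by exists (Some Y).
Qed.

Lemma occ_subst V N (t : term R L V N) N' (f : N -> term R L V N') X :
  occ X (tsubst Cst f t) <-> exists2 Y, occ Y t & occ X (f Y).
Proof.
elim: t N' f X => /= {N} [N v|N Y|N a t IH|N e t IHt s IHs|N b IH] N' f X.
- by split => // -[].
- by split => [h|[_ <-]//]; exists Y.
- exact: IH.
- rewrite IHt IHs; split => [[][Y Yo h]|[Y [Yo|Yo] h]]; try by exists Y; auto.
  + by left; exists Y.
  + by right; exists Y.
- rewrite (IH _ (up f)); split => [[[Y|] Yo //= /occ_ren[Z Zo [<-]]]|[Y Yo h]].
    by exists Y.
  by exists (Some Y) => //=; apply/occ_ren; exists X.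
Qed.

Lemma tsubst_ext V N (t : term R L V N) N' (f g : N -> term R L V N') :
  (forall X, occ X t -> f X = g X) -> tsubst Cst f t = tsubst Cst g t.
Proof.
elim: t N' f g => //= {N} [N Y|N a t IH|N e t IHt s IHs|N b IH] N' f g fg.
- exact: fg.
- by rewrite (IH _ f g).
- by rewrite (IHt _ f g) ?(IHs _ f g)// => X Xo; apply: fg; [right|left].
- by congr Rec; apply: IH => -[X|] //= Xo; rewrite fg.
Qed.

Lemma guarded_nocc V N (t : term R L V N) X : ~ occ X t -> guarded X t.
Proof.
elim: t X => //= {N} [N e t IHt s IHs|N b IH] X.
- by move=> /not_orP[/IHt ? /IHs ?]; split; right.
- exact: IH.
Qed.

Lemma guarded_ren V N (t : term R L V N) N' (f : N -> N') X :
  (forall Y, f Y = X -> guarded Y t) -> guarded X (ren f t).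
Proof.
elim: t N' f X => //= {N} [N Y|N e t IHt s IHs|N b IH] N' f X h.
- by move=> /h.
- split.
  + have [e0|ne0] := pselect (e%:num = 0); first by left.
    by right; apply: IHt => Y /h[[]].
  + have [e1|ne1] := pselect (e%:num = 1); first by left.
    by right; apply: IHs => Y /h[_ []].
- by apply: IH => -[Y|] //= [/h].
Qed.

Lemma guarded_subst V N (t : term R L V N) N' (f : N -> term R L V N') X :
  (forall Y, guarded Y t \/ guarded X (f Y)) -> guarded X (tsubst Cst f t).
Proof.
elim: t N' f X => //= {N} [N Y|N e t IHt s IHs|N b IH] N' f X h.
- by case: (h Y).
- split.
  + have [e0|ne0] := pselect (e%:num = 0); first by left.
    by right; apply: IHt => Y; case: (h Y) => [[[]]|]; auto.
  + have [e1|ne1] := pselect (e%:num = 1); first by left.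
    by right; apply: IHs => Y; case: (h Y) => [[_ []]|]; auto.
- apply: (IH _ (up f)) => -[Y|] /=; last by right.
  case: (h Y) => [|gf]; first by left.
  by right; apply: guarded_ren => Z [->].
Qed.

Lemma occ_finite V N (t : term R L V N) :
  exists A : set N, finite_set A /\ forall X, occ X t -> A X.
Proof.
elim: t => /= {N} [N v|N Y|N a t IH|N e t [A [fA hA]] s [B [fB hB]]|N b [A [fA hA]]].
- by exists set0; split.
- by exists [set Y]; split => // X ->.
- exact: IH.
- exists (A `|` B); split; first by rewrite finite_setU.
  by move=> X [/hA|/hB]; [left|right].
- exists (Some @^-1` A); split; last by move=> X /hA.
  by apply: finite_preimage => // x y _ _ [].
Qed.

End Syntax.

(** * Named binders and fresh names *)

Section Names.
Context {R : realType} {L : Type} {V : Type} {N : eqType}.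
Implicit Types (t s : term R L V N) (X : N).

Definition setv (f : N -> term R L V N) X s (Y : N) : term R L V N :=
  if Y == X then s else f Y.

Lemma nsubstE t X s : nsubst t X s = tsubst Cst (setv Var X s) t.
Proof. by []. Qed.

Lemma mu_def X t : mu X t = Rec (ren (fun Y => if Y == X then None else Some Y) t).
Proof. by []. Qed.

(** The rules speak of [mu X], the datatype of [Rec]. Opening the body with a name that is not free
    in [Rec b] and binding it again loses nothing, so every [Rec] may be treated as a named
    recursion. *)
Lemma Rec_mu X (b : term R L V (option N)) : ~ occ X (Rec b) ->
  Rec b = mu X (inst (Var X) b).
Proof.
move=> nX; rewrite mu_def ren_subst tsubst_inst /= eqxx; congr Rec.
rewrite -[LHS]tsubst_Var; apply: tsubst_ext => -[Y|] //= Yo.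
by case: eqP => // YX; rewrite YX in Yo.
Qed.

Lemma nsubst_inst X s (b : term R L V (option N)) : ~ occ X (Rec b) ->
  nsubst (inst (Var X) b) X s = inst s b.
Proof.
move=> nX; rewrite nsubstE tsubst_inst /= /setv eqxx; apply: tsubst_ext => -[Y|] //= Yo.
by case: eqP => // YX; rewrite YX in Yo.
Qed.

Lemma occ_mu X t Y : occ Y (mu X t) <-> occ Y t /\ Y <> X.
Proof.
rewrite /mu /= occ_ren; split => [[Z Zo]|[Yo YX]].
  by case: eqP => // ZX [<-].
by exists Y => //; case: eqP.
Qed.

Lemma tsubst_mu X t (f : N -> term R L V N) :
  f X = Var X -> (forall Y, occ Y t -> Y <> X -> ~ occ X (f Y)) ->
  tsubst Cst f (mu X t) = mu X (tsubst Cst f t).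
Proof.
move=> fX fY; rewrite !mu_def tsubst_Rec tsubst_ren ren_tsubst; congr Rec.
apply: tsubst_ext => Y Yo /=; case: eqP => [->|YX]; first by rewrite fX /= eqxx.
rewrite /= !ren_subst; apply: tsubst_ext => Z Zo /=.
by case: eqP => // ZX; rewrite ZX in Zo; case: (fY Y).
Qed.

Hypothesis infN : infinite_set [set: N].

Lemma fresh_name M M' (u : term R L V M) (u' : term R L V M')
    (f : N -> M) (f' : N -> M') : injective f -> injective f' ->
  exists X, ~ occ (f X) u /\ ~ occ (f' X) u'.
Proof.
move=> fI f'I; have [A [fA hA]] := occ_finite u; have [B [fB hB]] := occ_finite u'.
apply: contrapT => nex; apply: infN.
apply: (@sub_finite_set _ _ (f @^-1` A `|` f' @^-1` B)).
  move=> X _; apply: contrapT => /not_orP[nA nB]; apply: nex; exists X.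
  by split => [/hA|/hB].
rewrite finite_setU; split; apply: finite_preimage => // x y _ _; [exact: fI|exact: f'I].
Qed.

(** Structural induction descends to bodies over [option N], to which [P] does not apply. The claim
    is therefore proved for all images of open terms under maps of their names into [N]; at a binder
    the map is extended by a fresh name. *)
Lemma named_ind (P : term R L V N -> Prop) :
  (forall v, P (Cst v)) -> (forall X, P (Var X)) ->
  (forall a t, P t -> P (Pre a t)) ->
  (forall e t s, P t -> P s -> P (Sum e t s)) ->
  (forall X t, P t -> P (mu X t)) -> forall t, P t.
Proof.
move=> hC hV hP hS hM t; rewrite -(tsubst_Var t).
have : forall M (u : term R L V M) (f : M -> N), P (tsubst Cst (Var \o f) u).
  move=> M u; elim: u => //= {M} [M a u IH|M e u IHu s IHs|M b IH] f.
  - exact: hP.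
  - exact: hS.
  - rewrite -/(up (Var \o f)).
    set b' := tsubst _ _ b.
    have [X [nX _]] := @fresh_name _ _ (Rec b') (Rec b') id id (fun _ _ => id) (fun _ _ => id).
    rewrite (Rec_mu nX); apply: hM; rewrite /b' (_ : tsubst _ _ b = tsubst Cst (up (Var \o f)) b).
      rewrite inst_up; rewrite (_ : bcons _ _ = Var \o (bcons X f)); first exact: IH.
      by apply/funext => -[].
    by congr (tsubst _ _ _); apply/funext => -[].
by move=> /(_ _ t id); exact.
Qed.

End Names.

(** * Provable distance *)

Section Deduction.
Context {R : realType} {L W N : choiceType} {lambda : R}.
Implicit Types (t s u : term R L W N) (X : N) (e : {nonneg rat}).

Definition prov t e s := @derivable R L W N lambda set0 (Qeq t e s).
Definition eqv t s := prov t 0%:nng s.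

Lemma prov_cut (G : set (qeq R L W N)) t e s :
  derivable lambda G (Qeq t e s) -> (forall p, G p -> derivable lambda set0 p) ->
  prov t e s.
Proof. by move=> Gt Gp; exact: Cut Gp Gt. Qed.

Lemma provC t s e : prov t e s -> prov s e t.
Proof. by move=> ts; apply: prov_cut (Symm _ _ _ _) _ => p ->. Qed.

Lemma prov_trans u t s e e' e'' : e''%:num = e%:num + e'%:num ->
  prov t e u -> prov u e' s -> prov t e'' s.
Proof.
move=> ee tu us; rewrite (_ : e'' = (e%:num + e'%:num)%:nng); last exact: val_inj.
by apply: prov_cut (Triang _ _ _ u _ _) _ => p /= -[] ->.
Qed.

Lemma prov_le t s e e' : e%:num <= e'%:num -> prov t e s -> prov t e' s.
Proof.
rewrite le_eqVlt => /predU1P[/val_inj <-//|ee' ts].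
have d0 : 0 <= e'%:num - e%:num by rewrite subr_ge0 ltW.
rewrite (_ : e' = (e%:num + (NngNum d0)%:num)%:nng); last first.
  by apply: val_inj => /=; rewrite addrC subrK.
by apply: prov_cut (Max _ _ _ _ _) _ => [|p ->//]; rewrite /= subr_gt0.
Qed.

Lemma prov_arch t s e : (forall e', e%:num < e'%:num -> prov t e' s) -> prov t e s.
Proof.
by move=> h; apply: prov_cut (Arch _ _ _ _) _ => p [e' /= ee' <-]; exact: h.
Qed.

Lemma eqv_refl t : eqv t t. Proof. exact: Refl. Qed.
Lemma eqv_sym t s : eqv t s -> eqv s t. Proof. exact: provC. Qed.
Lemma eqv_trans u t s : eqv t u -> eqv u s -> eqv t s.
Proof. by apply: prov_trans; rewrite addr0. Qed.
Hint Resolve eqv_refl : core.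

Lemma prov_eqv t t' s s' e : eqv t t' -> eqv s s' -> prov t' e s' -> prov t e s.
Proof.
move=> tt' ss' ts; apply: (prov_trans (e' := e) _ tt'); first by rewrite add0r.
by apply: (prov_trans (e' := 0%:nng) _ ts); [rewrite addr0|exact: eqv_sym].
Qed.

Lemma eqv_Sum (e : {i01 R}) t t' s s' : eqv t s -> eqv t' s' -> eqv (Sum e t t') (Sum e s s').
Proof.
move=> ts ts'; apply: prov_cut (IB _ t s t' s' (eps := 0%:nng) (eps' := 0%:nng) _) _.
  by rewrite (rmorph0 (ratr : rat -> R)) !mulr0 addr0.
by move=> p /= -[] ->.
Qed.

Lemma eqv_Pre a t s : eqv t s -> eqv (Pre a t) (Pre a s).
Proof. by move=> ts; apply: prov_cut (Pref _ _ _ _ _) _ => p ->. Qed.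

Lemma eqv_mu X t s : eqv t s -> eqv (mu X t) (mu X s).
Proof. by move=> ts; apply: prov_cut (Cong _ _ _ _) _ => p ->. Qed.

Lemma eqv_fix X t s : guarded X t -> eqv s (nsubst t X s) -> eqv s (mu X t).
Proof. by move=> gt st; apply: prov_cut (Fix _ _ gt) _ => p ->. Qed.

Lemma eqv_unfold X t : eqv (mu X t) (nsubst t X (mu X t)).
Proof. exact: Unfold. Qed.

Lemma eqv_unguard X t (e : {i01 R}) : eqv (mu X (Sum e t (Var X))) (mu X t).
Proof. exact: Unguard. Qed.

Definition distances t s : set R := [set ratr e%:num | e in (prov t)^~ s].

Definition dist t s : R := inf (distances t s).

Lemma prov_has_inf t s : has_inf (distances t s).
Proof.
split; first by exists (ratr 1%:nng%:num), 1%:nng => //; exact: Top.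
by exists 0 => _ [e _ <-]; rewrite ler0q.
Qed.

Lemma dist_le t s e : prov t e s -> dist t s <= ratr e%:num.
Proof. by move=> ts; apply: ge_inf; [exact: (prov_has_inf t s).2|exists e]. Qed.

Lemma dist_ge0 t s : 0 <= dist t s.
Proof.
by apply: lb_le_inf; [exact: (prov_has_inf t s).1|move=> _ [e _ <-]; rewrite ler0q].
Qed.

Lemma dist_le1 t s : dist t s <= 1.
Proof. by rewrite -[leRHS](rmorph1 (ratr : rat -> R)); apply: (@dist_le _ _ 1%:nng); exact: Top. Qed.

Lemma dist_eqv t t' s s' : eqv t t' -> eqv s s' -> dist t s = dist t' s'.
Proof.
move=> tt' ss'; congr inf; apply/seteqP; split => _ [e /= ts <-]; exists e => //=.
- exact: prov_eqv (eqv_sym tt') (eqv_sym ss') ts.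
- exact: prov_eqv ts.
Qed.

Lemma dist_prov t s e : dist t s < ratr e%:num -> prov t e s.
Proof.
move=> /inf_lt[|_ [e' /= ts <-]]; first exact: (prov_has_inf t s).1.
by rewrite ltr_rat => /ltW ee'; exact: prov_le ts.
Qed.

(** (Arch) turns derivability at all tolerances above [e] into derivability at [e], so the boundary
    case, where the infimum might not come from a derivation, is included. *)
Lemma dist_prov_le t s e : dist t s <= ratr e%:num -> prov t e s.
Proof.
move=> le; apply: prov_arch => e' ee'; apply: dist_prov.
by apply: le_lt_trans le _; rewrite ltr_rat.
Qed.

Lemma dist_eq0 t s : dist t s = 0 <-> eqv t s.
Proof.
split=> [d0|ts]; first by apply: dist_prov_le; rewrite d0 (rmorph0 (ratr : rat -> R)).
by apply/le_anti; rewrite dist_ge0 andbT; have := dist_le ts; rewrite (rmorph0 (ratr : rat -> R)).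
Qed.

Lemma distxx t : dist t t = 0. Proof. exact/dist_eq0. Qed.

(** Tolerances are rational but the bounds needed below are real; a rational strictly between [r]
    and [dist t s] would contradict the hypothesis. *)
Lemma le_dist_rat t s (r : R) : 0 <= r ->
  (forall e, r < ratr e%:num -> prov t e s) -> dist t s <= r.
Proof.
move=> r0 h; rewrite leNgt; apply/negP => /rat_in_itvoo[q].
rewrite in_itv /= => /andP[rq qd].
have q0 : 0 <= q by rewrite -(ler0q R) (le_trans r0)// ltW.
by have := dist_le (h (NngNum q0) rq); rewrite leNgt qd.
Qed.

Lemma dist_Sum (e : {i01 R}) t t' s s' :
  dist (Sum e t t') (Sum e s s') <= e%:num * dist t s + (1 - e%:num) * dist t' s'.
Proof.
have e0 : 0 <= e%:num by [].
have e1 : 0 <= 1 - e%:num by rewrite subr_ge0.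
apply: le_dist_rat => [|f hf]; first by rewrite addr_ge0// mulr_ge0// dist_ge0.
(* The slack between the rational target and the real bound. Either premise may exceed its distance
   by [g], because the two weights sum to 1. *)
pose g : R := ratr f%:num - (e%:num * dist t s + (1 - e%:num) * dist t' s').
have g0 : 0 < g by rewrite subr_gt0.
have [_ [f1 /= ts <-] h1] := inf_adherent g0 (prov_has_inf t s).
have [_ [f2 /= ts' <-] h2] := inf_adherent g0 (prov_has_inf t' s').
apply: prov_cut (IB _ t s t' s' (eps := f1) (eps' := f2) _) _; last first.
  by move=> p /= -[] ->.
have := lerD (ler_wpM2l e0 (ltW h1)) (ler_wpM2l e1 (ltW h2)).
rewrite -/(dist t s) -/(dist t' s') => /le_trans; apply.
by rewrite [leLHS](_ : _ = e%:num * dist t s + (1 - e%:num) * dist t' s' + g);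
  [rewrite /g addrC subrK|ring].
Qed.

Lemma dist_Pre a t s : 0 <= lambda -> dist (Pre a t) (Pre a s) <= lambda * dist t s.
Proof.
move=> l0; apply: le_dist_rat => [|f hf]; first by rewrite mulr_ge0// dist_ge0.
pose g : R := ratr f%:num - lambda * dist t s.
(* The denominator is positive even for [lambda = 0], and an excess [g / (1 + lambda)] of the
   premise becomes at most [g] after multiplication by [lambda]. *)
have g0 : 0 < g / (1 + lambda) by rewrite divr_gt0 ?subr_gt0// ltr_wpDr.
have [_ [f1 /= ts <-] h1] := inf_adherent g0 (prov_has_inf t s).
apply: prov_cut (LPref _ _ _ (eps := f1) _) _; last by move=> p /= ->.
have := ler_wpM2l l0 (ltW h1); rewrite -/(dist t s) => /le_trans; apply.
rewrite mulrDr -lerBrDl -/g mulrCA; apply: ler_piMr; first by rewrite subr_ge0 ltW.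
by rewrite ltW// ltr_pdivrMr ?mul1r ?ltrDr// ltr_wpDr.
Qed.

End Deduction.

(** * Convex combinations *)

Section Expectation.
Context {R : realType}.
Implicit Types K J : Type.

(* Finite measures are lists of weighted points; [Ex l phi] is the integral. *)
Definition Ex {K} (l : seq (R * K)) (phi : K -> R) : R := \sum_(x <- l) x.1 * phi x.2.
Definition tot {K} (l : seq (R * K)) : R := Ex l (fun=> 1).
Definition push {K J} (c : R) (g : K -> J) (l : seq (R * K)) : seq (R * J) :=
  [seq (c * x.1, g x.2) | x <- l].
Definition nonneg {K} (l : seq (R * K)) : bool := all (fun x => 0 <= x.1) l.

Lemma Ex_nil K (phi : K -> R) : Ex [::] phi = 0. Proof. exact: big_nil. Qed.

Lemma Ex_cons K p (k : K) l phi : Ex ((p, k) :: l) phi = p * phi k + Ex l phi.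
Proof. exact: big_cons. Qed.

Lemma Ex_cat K (l l' : seq (R * K)) phi : Ex (l ++ l') phi = Ex l phi + Ex l' phi.
Proof. exact: big_cat. Qed.

Lemma Ex_push K J c (g : K -> J) l phi : Ex (push c g l) phi = c * Ex l (phi \o g).
Proof.
by rewrite /Ex /push big_map mulr_sumr; apply: eq_bigr => x _; rewrite mulrA.
Qed.

Lemma ExD K (l : seq (R * K)) phi psi :
  Ex l (fun k => phi k + psi k) = Ex l phi + Ex l psi.
Proof. by rewrite /Ex -big_split; apply: eq_bigr => x _; rewrite mulrDr. Qed.

Lemma ExZ K (l : seq (R * K)) c phi : Ex l (fun k => c * phi k) = c * Ex l phi.
Proof. by rewrite /Ex mulr_sumr; apply: eq_bigr => x _; rewrite mulrCA. Qed.

Lemma Ex_ge0 K (l : seq (R * K)) phi :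
  nonneg l -> (forall k, 0 <= phi k) -> 0 <= Ex l phi.
Proof.
move=> + phi0; elim: l => [|[p k] l IH]; first by rewrite Ex_nil.
by move=> /= /andP[p0 /IH l0]; rewrite Ex_cons addr_ge0// mulr_ge0.
Qed.

Lemma Ex_le K (l : seq (R * K)) phi psi :
  nonneg l -> (forall k, phi k <= psi k) -> Ex l phi <= Ex l psi.
Proof.
move=> l0 h; rewrite -subr_ge0 -mulN1r -ExZ -ExD; apply: Ex_ge0 => // k.
by rewrite mulN1r subr_ge0.
Qed.

Lemma Ex_ext K (l : seq (R * K)) phi psi :
  (forall k, phi k = psi k) -> Ex l phi = Ex l psi.
Proof. by move=> /funext ->. Qed.

(** A nonnegative [psi] of integral 0 vanishes at each point of positive weight, and points of
    weight 0 do not count. Since the lists may contain such points, facts on supports are phrased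
    below as vanishing integrals. *)
Lemma Ex_eq0 K (l : seq (R * K)) phi psi :
  nonneg l -> (forall k, 0 <= psi k) -> Ex l psi = 0 ->
  (forall k, psi k = 0 -> phi k = 0) -> Ex l phi = 0.
Proof.
move=> + psi0 + h; elim: l => [|[p k] l IH]; first by rewrite !Ex_nil.
move=> /= /andP[p0 l0]; rewrite !Ex_cons => /eqP.
rewrite paddr_eq0 ?mulr_ge0 ?Ex_ge0// mulf_eq0 => /andP[/orP[] /eqP pk /eqP /(IH l0) ->].
  by rewrite pk mul0r addr0.
by rewrite h// mulr0 addr0.
Qed.

Lemma nonneg_push K J c (g : K -> J) l : 0 <= c -> nonneg l -> nonneg (push c g l).
Proof.
move=> c0; rewrite /nonneg all_map; apply: sub_all => x /=; exact: mulr_ge0.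
Qed.

Definition mass {K : eqType} (l : seq (R * K)) (k : K) : R := Ex l (fun j => (j == k)%:R).

Lemma mass_ge0 (K : eqType) (l : seq (R * K)) k : nonneg l -> 0 <= mass l k.
Proof. by move=> l0; apply: Ex_ge0. Qed.

Definition others {K : eqType} (k : K) (l : seq (R * K)) := [seq x <- l | x.2 != k].

Lemma Ex_others (K : eqType) (l : seq (R * K)) k phi :
  Ex l phi = mass l k * phi k + Ex (others k l) phi.
Proof.
elim: l => [|[p j] l IH] /=; first by rewrite /mass !Ex_nil mul0r addr0.
rewrite /mass !Ex_cons -/(mass l k); case: eqP => [->|_] /=.
  by rewrite IH mulr1 mulrDl addrA.
by rewrite Ex_cons mulr0 add0r IH addrCA.
Qed.

Lemma nonneg_others (K : eqType) (l : seq (R * K)) k : nonneg l -> nonneg (others k l).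
Proof.
by move=> /allP l0; apply/allP => x; rewrite mem_filter => /andP[_ /l0].
Qed.

Lemma mass_others (K : eqType) (l : seq (R * K)) k j :
  mass (others k l) j = if j == k then 0 else mass l j.
Proof.
elim: l => [|[p i] l IH] /=; first by rewrite /mass !Ex_nil if_same.
rewrite [in RHS]/mass Ex_cons -/(mass l j); have [->|ik] := eqVneq i k => /=.
  by rewrite IH (eq_sym k); case: eqP => //; rewrite mulr0 add0r.
rewrite /mass Ex_cons -/(mass _ j) IH.
by have [->|] := eqVneq j k => //; rewrite (negbTE ik) mulr0 addr0.
Qed.

Lemma tot_eq0 (K : eqType) (l : seq (R * K)) :
  nonneg l -> (forall k, mass l k = 0) -> tot l = 0.
Proof.
elim: l => [|[p k] l IH] /=; first by rewrite /tot Ex_nil.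
move=> /andP[p0 l0] h; rewrite /tot Ex_cons mulr1 -/(tot l).
have hj j : mass ((p, k) :: l) j = p * (k == j)%:R + mass l j by exact: Ex_cons.
have l_eq0 j : mass l j = 0.
  by apply/le_anti; rewrite mass_ge0// andbT -[leRHS](h j) hj lerDr mulr_ge0.
by have := h k; rewrite hj eqxx mulr1 l_eq0 addr0 => ->; rewrite add0r IH.
Qed.

Lemma Ex_mass (K : eqType) (l : seq (R * K)) (r : seq K) phi :
  uniq r -> (forall k, k \notin r -> mass l k = 0) -> nonneg l ->
  Ex l phi = \sum_(k <- r) mass l k * phi k.
Proof.
elim: r l => [|k r IH] l /=.
  move=> _ h l0; rewrite big_nil; apply: (Ex_eq0 (psi := fun=> 1)) => //; last first.
    by move=> k /eqP; rewrite oner_eq0.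
  by apply: tot_eq0 => // k; exact: h.
move=> /andP[kr ur] h l0; rewrite big_cons (Ex_others _ k); congr (_ + _).
rewrite IH ?nonneg_others//.
  rewrite [LHS]big_seq [RHS]big_seq; apply: eq_bigr => j jr; rewrite mass_others.
  by case: eqP => // jk; rewrite jk (negbTE kr) in jr.
move=> j jr; rewrite mass_others; case: eqP => // /eqP jk.
by apply: h; rewrite inE negb_or jk.
Qed.

End Expectation.

(** * Provable laws of normalised convex combinations *)

Section ConvexCombinations.
Context {R : realType} {L W N : choiceType} {lambda : R}.
Implicit Types (t s u : term R L W N) (p q r : R).
Local Notation eqv := (@eqv R L W N lambda).
Local Notation dist := (@dist R L W N lambda).

(** Weights of [Sum] carry a proof of lying in the unit interval. Clipping makes every real usable
    as a weight, with default 0, and moves the range check to where the value matters. *)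
Lemma clip_subproof (x : R) : {e : {i01 R} | 0 <= x <= 1 -> e%:num = x}.
Proof.
have [x01|_] := boolP (0 <= x <= 1); last by exists (Itv01 (lexx 0) ler01).
by exists (Itv01 (andP x01).1 (andP x01).2).
Qed.

Definition clip (x : R) : {i01 R} := sval (clip_subproof x).

Lemma clipE x : 0 <= x <= 1 -> (clip x)%:num = x.
Proof. exact: (svalP (clip_subproof x)). Qed.

Lemma eqv_SC (e e' : {i01 R}) t s : e'%:num = 1 - e%:num ->
  eqv (Sum e t s) (Sum e' s t).
Proof.
move=> ee; rewrite (_ : e' = (1 - e%:num)%:i01); first exact: SC.
exact: val_inj.
Qed.

Lemma eqv_SA (e e' f g : {i01 R}) t s u : e%:num < 1 -> e'%:num < 1 ->
  f%:num = (e'%:num - e%:num * e'%:num) / (1 - e%:num * e'%:num) ->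
  g%:num = e%:num * e'%:num ->
  eqv (Sum e' (Sum e t s) u) (Sum g t (Sum f s u)).
Proof.
move=> e1 e'1 ff gg; rewrite (_ : g = (e%:num * e'%:num)%:i01); first exact: SA.
exact: val_inj.
Qed.

(* The convex combination with unnormalised weights [p], [q]; it is only
   meaningful if [0 < p + q]. *)
Definition mix p t q s : term R L W N := Sum (clip (p / (p + q))) t s.

Lemma frac_itv p q : 0 <= p -> 0 <= q -> 0 < p + q -> 0 <= p / (p + q) <= 1.
Proof.
by move=> p0 q0 pq; rewrite divr_ge0 ?(ltW pq)//= ler_pdivrMr// mul1r lerDl.
Qed.

Lemma clip_frac p q : 0 <= p -> 0 <= q -> 0 < p + q ->
  (clip (p / (p + q)))%:num = p / (p + q).
Proof. by move=> *; rewrite clipE// frac_itv. Qed.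

Lemma mixC p q t s : 0 <= p -> 0 <= q -> 0 < p + q -> eqv (mix p t q s) (mix q s p t).
Proof.
move=> p0 q0 pq; have qp : 0 < q + p by rewrite addrC.
have pq0 : p + q != 0 by rewrite gt_eqF.
by apply: eqv_SC; rewrite !clip_frac// (addrC q); field.
Qed.

Lemma mix1 p t s : 0 < p -> eqv (mix p t 0 s) t.
Proof.
by move=> p0; apply: B1; rewrite clip_frac ?addr0 ?(ltW p0)// divff// gt_eqF.
Qed.

Lemma mix0 q t s : 0 < q -> eqv (mix 0 t q s) s.
Proof.
move=> q0; apply: (eqv_trans _ (mix1 s t q0)).
by apply: mixC => //; [exact: ltW|rewrite add0r].
Qed.

Lemma mixxx p q t : eqv (mix p t q t) t.
Proof. exact: B2. Qed.

Lemma dist_mix p q t s t' s' : 0 <= p -> 0 <= q -> 0 < p + q ->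
  (p + q) * dist (mix p t q s) (mix p t' q s') <= p * dist t t' + q * dist s s'.
Proof.
move=> p0 q0 pq; rewrite mulrC -ler_pdivlMr//; apply: le_trans (dist_Sum _ _ _ _ _) _.
have pq0 : p + q != 0 by rewrite gt_eqF.
by rewrite clip_frac// le_eqVlt; apply/orP; left; apply/eqP; field.
Qed.

(** Passing through the distance multiplies each difference by its weight, so a summand of weight 0
    may be replaced by anything. *)
Lemma eqv_mix p q t s t' s' : 0 <= p -> 0 <= q -> 0 < p + q ->
  (0 < p -> eqv t t') -> (0 < q -> eqv s s') -> eqv (mix p t q s) (mix p t' q s').
Proof.
move=> p0 q0 pq tt ss; apply/dist_eq0/le_anti; rewrite dist_ge0 andbT.
rewrite -(pmulr_rle0 _ pq); apply: le_trans (dist_mix _ _ _ _ _ _ _) _ => //.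
have -> : p * dist t t' = 0.
  move: p0; rewrite le_eqVlt => /predU1P[<-|/tt/dist_eq0 ->]; first by rewrite mul0r.
  by rewrite mulr0.
move: q0; rewrite le_eqVlt => /predU1P[<-|/ss/dist_eq0 ->]; first by rewrite mul0r addr0.
by rewrite mulr0 addr0.
Qed.

(** (SA) requires both weights below 1, which corresponds to [q] and [r] being positive; if one of
    them is 0, the combination collapses by [mix1] or [mix0]. *)
Lemma mixA p q r t s u : 0 <= p -> 0 <= q -> 0 <= r -> 0 < p + q + r ->
  eqv (mix p t (q + r) (mix q s r u)) (mix (p + q) (mix p t q s) r u).
Proof.
move=> p0 q0; rewrite le_eqVlt => /predU1P[<-|r0 pqr].
  rewrite !addr0 => pq; apply: (eqv_trans _ (eqv_sym (mix1 _ _ pq))).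
  by apply: eqv_mix => // h; [exact: eqv_refl|exact: mix1].
move: q0; rewrite le_eqVlt => /predU1P[q0|q0].
  rewrite -q0 add0r addr0 in pqr *; apply: eqv_mix; rewrite ?(ltW r0)// => h.
    by apply: eqv_sym; exact: mix1.
  exact: mix0.
have pq : 0 < p + q by rewrite ltr_wpDl.
have qr : 0 < q + r by rewrite addr_gt0.
have [pq0 qr0 pqr0] : [/\ p + q != 0, q + r != 0 & p + q + r != 0].
  by split; rewrite gt_eqF.
have lt1 (x y : R) : 0 <= x -> 0 < y -> x / (x + y) < 1.
  by move=> x0 y0; rewrite ltr_pdivrMr; [rewrite mul1r ltrDl|exact: ltr_wpDl].
have pqrA : 0 < p + (q + r) by rewrite addrA.
apply: eqv_sym; rewrite /mix; apply: eqv_SA.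
- by rewrite clip_frac ?(ltW q0)// lt1.
- by rewrite clip_frac ?(ltW pq) ?(ltW r0)// lt1// ltW.
- rewrite !clip_frac ?(ltW pq) ?(ltW q0) ?(ltW r0)//.
  have -> : 1 - p / (p + q) * ((p + q) / (p + q + r)) = (q + r) / (p + q + r).
    by field; rewrite pq0 pqr0.
  by field; rewrite pq0 qr0 pqr0.
- rewrite !clip_frac ?(ltW pq) ?(ltW q0) ?(ltW r0) ?(ltW qr)// addrA.
  by field; rewrite pq0 pqr0.
Qed.

Lemma mixCA p q r t s u : 0 <= p -> 0 <= q -> 0 <= r -> 0 < p + q + r ->
  eqv (mix p t (q + r) (mix q s r u)) (mix q s (p + r) (mix p t r u)).
Proof.
move=> p0 q0 r0 pqr; apply: eqv_trans (mixA _ _ _ _ _ _ _) _ => //.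
have qpr : 0 < q + p + r by rewrite (addrC q).
apply: (eqv_trans _ (eqv_sym (mixA _ _ _ _ _ _ _))) => //.
rewrite (addrC q); apply: eqv_mix; rewrite ?addr_ge0// => pq; last exact: eqv_refl.
exact: mixC.
Qed.

Definition bot : term R L W N := Rec (Var None).

(** Each tail is weighted by its own total, so the weights need not sum to 1; for total 0 the value
    is a placeholder. *)
Fixpoint csum {K : Type} (h : K -> term R L W N) (l : seq (R * K)) : term R L W N :=
  if l is (p, k) :: l' then mix p (h k) (tot l') (csum h l') else bot.

Lemma csum_cons K (h : K -> term R L W N) p k l :
  csum h ((p, k) :: l) = mix p (h k) (tot l) (csum h l).
Proof. by []. Qed.

Lemma tot_ge0 K (l : seq (R * K)) : nonneg l -> 0 <= tot l.
Proof. by move=> l0; apply: Ex_ge0. Qed.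

Lemma tot_cons K p (k : K) l : tot ((p, k) :: l) = p + tot l.
Proof. by rewrite /tot Ex_cons mulr1. Qed.

(** [mix] depends only on the ratio of its weights, so a common positive factor cancels and the two
    terms are equal, not just provably so. *)
Lemma csum_push K J c (g : K -> J) h l : 0 < c -> csum h (push c g l) = csum (h \o g) l.
Proof.
move=> c0; elim: l => [//|[p k] l IH] /=; rewrite IH; congr (Sum (clip _) _ _).
rewrite /tot Ex_push -/(tot l) /= -mulrDr -mulf_div divff ?mul1r//.
by rewrite gt_eqF.
Qed.

(** The factor [tot l] clears the denominators of the nested [mix], which keeps the bound linear and
    true for tails of total 0, where [csum] is a placeholder. *)
Lemma csum_dist K (h h' : K -> term R L W N) l : nonneg l ->
  tot l * dist (csum h l) (csum h' l) <= Ex l (fun k => dist (h k) (h' k)).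
Proof.
elim: l => [|[p k] l IH] /=; first by rewrite /tot !Ex_nil mul0r.
move=> /andP[p0 l0]; rewrite tot_cons Ex_cons.
have := addr_ge0 p0 (tot_ge0 l0); rewrite le_eqVlt => /predU1P[<-|pl].
  rewrite mul0r addr_ge0 ?mulr_ge0 ?dist_ge0// Ex_ge0// => j; exact: dist_ge0.
apply: le_trans (dist_mix _ _ _ _ _ _ pl) _; rewrite ?tot_ge0//.
by rewrite lerD2l IH.
Qed.

Lemma eqv_csum K (h h' : K -> term R L W N) l : nonneg l -> 0 < tot l ->
  (forall x, List.In x l -> 0 < x.1 -> eqv (h x.2) (h' x.2)) ->
  eqv (csum h l) (csum h' l).
Proof.
move=> l0 lt hh; apply/dist_eq0/le_anti; rewrite dist_ge0 andbT -(pmulr_rle0 _ lt).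
apply: le_trans (csum_dist _ _ l0) _.
elim: l l0 {lt} hh => [|[p k] l IH] /=; first by rewrite Ex_nil.
move=> /andP[p0 l0] hh; rewrite Ex_cons.
have := IH l0 (fun x xl => hh x (or_intror xl)); apply: le_trans; rewrite gerDr.
move: p0; rewrite le_eqVlt => /predU1P[<-|p0]; first by rewrite mul0r.
by rewrite (dist_eq0 _ _).2 ?mulr0//; apply: (hh (p, k)) => //; left.
Qed.

Lemma csum_cat K (h : K -> term R L W N) l l' : nonneg l -> nonneg l' ->
  0 < tot l + tot l' -> eqv (csum h (l ++ l')) (mix (tot l) (csum h l) (tot l') (csum h l')).
Proof.
move=> + l'0; elim: l => [_|[p k] l IH /= /andP[p0 l0]].
  by rewrite /tot Ex_nil add0r => l'p /=; apply: eqv_sym; exact: mix0.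
rewrite !tot_cons => pll.
apply: (eqv_trans _ (mixA _ _ _ _ _ _ _)); rewrite ?tot_ge0//.
rewrite {1}/tot Ex_cat; apply: eqv_mix => //; rewrite ?addr_ge0 ?tot_ge0 ?addrA//.
- by move=> _; exact: eqv_refl.
- exact: IH.
Qed.

Lemma csum_others (K : eqType) (h : K -> term R L W N) l k : nonneg l -> 0 < tot l ->
  eqv (csum h l) (csum h ((mass l k, k) :: others k l)).
Proof.
elim: l => [|[p j] l IH]; first by rewrite /tot Ex_nil ltxx.
move=> /[dup] jl0 /= /andP[p0 l0]; rewrite tot_cons => pl.
have totE : tot l = mass l k + tot (others k l) by rewrite {1}/tot (Ex_others _ k) mulr1.
have m0 := mass_ge0 k l0; have o0 := tot_ge0 (nonneg_others k l0).
apply: (@eqv_trans _ _ _ _ _ (mix p (h j) (mass l k + tot (others k l))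
    (mix (mass l k) (h k) (tot (others k l)) (csum h (others k l))))).
  rewrite totE; apply: eqv_mix; rewrite -?totE ?tot_ge0//.
  - by move=> _; exact: eqv_refl.
  - exact: IH.
rewrite totE in pl.
have -> : mass ((p, j) :: l) k = p * (j == k)%:R + mass l k by exact: Ex_cons.
rewrite /others /= -/(others k l); case: eqP => [->|_] /=.
  rewrite mulr1; apply: eqv_trans (mixA _ _ _ _ _ _ _) _; rewrite -?addrA//.
  apply: eqv_mix; rewrite ?addr_ge0 -?addrA// => _; last exact: eqv_refl.
  exact: mixxx.
rewrite mulr0 add0r tot_cons; apply: mixCA => //.
by rewrite -addrA.
Qed.

(** The barycentric laws make a convex combination depend only on the mass of each point. All
    occurrences of the first key are moved to the front of both lists; the remainders again have
    equal masses, and the first list has become shorter. *)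
Lemma csum_mass (K : eqType) (h : K -> term R L W N) l l' :
  nonneg l -> nonneg l' -> 0 < tot l -> (forall k, mass l k = mass l' k) ->
  eqv (csum h l) (csum h l').
Proof.
move: {2}(size l).+1 (ltnSn (size l)) => n; elim: n l l' => // n IH [|[p k] l] l'.
  by move=> _ _ _; rewrite /tot Ex_nil ltxx.
move=> szl l0 l'0 lt ll'.
set l1 := (p, k) :: l in szl l0 lt ll' *.
have tot_eq : tot l1 = tot l'.
  pose r := undup ([seq x.2 | x <- l1] ++ [seq x.2 | x <- l']).
  have mr (l2 : seq (R * K)) j : {subset [seq x.2 | x <- l2] <= r} -> j \notin r -> mass l2 j = 0.
    move=> sub jr; rewrite /mass /Ex big_seq big1// => x xl2.
    case: eqP => [xj|_]; last by rewrite mulr0.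
    by move: jr; rewrite -xj sub// map_f.
  rewrite /tot !(@Ex_mass _ _ _ r) ?undup_uniq//.
  - by apply: eq_bigr => j _; rewrite ll'.
  - by move=> j; apply: mr => y; rewrite mem_undup mem_cat => ->; rewrite orbT.
  - by move=> j; apply: mr => y; rewrite mem_undup mem_cat => ->.
have l't : 0 < tot l' by rewrite -tot_eq.
apply: eqv_trans (csum_others h k l0 lt) _.
apply: (eqv_trans _ (eqv_sym (csum_others h k l'0 l't))).
rewrite !csum_cons -ll'.
have otot_eq : tot (others k l1) = tot (others k l').
  by move: tot_eq; rewrite /tot (Ex_others l1 k) (Ex_others l' k) ll' => /addrI.
rewrite -otot_eq; apply: eqv_mix; rewrite ?mass_ge0 ?tot_ge0 ?nonneg_others//.
- by move: lt; rewrite {1}/tot (Ex_others _ k) mulr1.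
- by move=> _; exact: eqv_refl.
move=> ot; apply: IH => //; try exact: nonneg_others.
- by rewrite /l1 /others /= eqxx (leq_ltn_trans (size_subseq (filter_subseq _ _))).
- by move=> j; rewrite !mass_others ll'.
Qed.

End ConvexCombinations.

(** * Guarded systems *)

Section Systems.
Context {R : realType} {L W N : choiceType} {lambda : R}.
Hypothesis infN : infinite_set [set: N].
Local Notation eqv := (@eqv R L W N lambda).

Lemma fresh_names (t s : term R L W N) : exists X, ~ occ X t /\ ~ occ X s.
Proof. by apply: (@fresh_name _ _ _ _ infN _ _ t s id id). Qed.

(** (Cong) needs a derivation between terms over [N], whereas bodies live over [option N]. Opening
    both bodies with one fresh name turns the shifted substitutions into substitutions with values
    over [N] again. *)
Lemma eqv_subst M (t : term R L W M) (f f' : M -> term R L W N) :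
  (forall X, occ X t -> eqv (f X) (f' X)) -> eqv (tsubst Cst f t) (tsubst Cst f' t).
Proof.
elim: t f f' => /= {M} [M v|M Y|M a t IH|M e t IHt s IHs|M b IH] f f' ff'.
- exact: eqv_refl.
- exact: ff'.
- by apply: eqv_Pre; exact: IH.
- by apply: eqv_Sum; [apply: IHt|apply: IHs] => X Xo; apply: ff'; [left|right].
rewrite -/(up f) -/(up f') -!tsubst_Rec !tsubst_Rec.
have [X [Xf Xf']] := fresh_names (Rec (tsubst Cst (up f) b)) (Rec (tsubst Cst (up f') b)).
rewrite (Rec_mu Xf) (Rec_mu Xf') !inst_up; apply: eqv_mu; apply: IH => -[Y|] /= Yo.
  exact: ff'.
exact: eqv_refl.
Qed.

(** Solutions must not mention the unknowns: an unknown that serves as the bound name of a [mu]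
    during elimination would capture them. *)
Definition solves (xs : seq N) (T f : N -> term R L W N) :=
  (forall Y, Y \notin xs -> f Y = Var Y) /\
  (forall X Y, X \in xs -> Y \in xs -> ~ occ X (f Y)) /\
  (forall X, X \in xs -> eqv (f X) (tsubst Cst f (T X))).

(* Gaussian elimination: the equation of the first variable [x] is solved by
   [mu x (T x)]. *)
Theorem guarded_system (xs : seq N) (T : N -> term R L W N) :
  uniq xs -> (forall X Y, X \in xs -> Y \in xs -> guarded X (T Y)) ->
  exists g, [/\ solves xs T g,
    forall Y Z, Y \in xs -> occ Z (g Y) -> exists2 X, X \in xs & occ Z (T X) &
    forall f, solves xs T f -> forall X, X \in xs -> eqv (f X) (g X)].
Proof.
elim: xs T => [|x xs IH] T.
  by move=> _ _; exists Var; split => //; split=> //; split.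
rewrite cons_uniq => /andP[xxs uxs] gT; set G := mu x (T x).
pose T' Y := nsubst (T Y) x G.
have xG : ~ occ x G by rewrite occ_mu => -[].
have xT' Y : ~ occ x (T' Y).
  by rewrite /T' nsubstE occ_subst => -[Z _]; rewrite /setv; case: eqP => //= ZX /ZX.
have inx X : X \in xs -> X \in x :: xs by rewrite inE orbC => ->.
have xx : x \in x :: xs by rewrite mem_head.
have nx X : X \in xs -> X != x by apply: contraTneq => ->.
have gT' X Y : X \in xs -> Y \in xs -> guarded X (T' Y).
  move=> Xxs Yxs; apply: guarded_subst => Z; rewrite /setv.
  have [->|Zx] := eqVneq Z x; first by left; apply: gT => //; exact: inx.
  have [->|ZX] := eqVneq Z X; first by left; apply: gT => //; exact: inx.
  by right => /= ZX'; rewrite ZX' eqxx in ZX.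
have [g' [[gV [gN gE]] gO gU]] := IH T' uxs gT'.
(* The names of [g' Y] come from the equations [T'], which no longer contain [x]; the occurrence
   clause of the statement is there for this. *)
have gx Y : Y \in xs -> ~ occ x (g' Y) by move=> Yxs /gO[//|Z _ /xT'].
pose g := setv g' x (tsubst Cst g' G).
have gxs X : X \in xs -> g X = g' X by rewrite /g /setv => /nx/negbTE ->.
have g'x : g' x = Var x by exact: gV.
have GE : tsubst Cst g' G = mu x (tsubst Cst g' (T x)).
  apply: tsubst_mu => // Y _ Yx; have [/gx//|Yxs] := boolP (Y \in xs).
  by rewrite gV.
have TE f X Y : (forall Z, Z \notin xs -> f Z = Var Z) ->
    tsubst Cst f (nsubst (T Y) x X) = tsubst Cst (setv f x (tsubst Cst f X)) (T Y).
  move=> fV; rewrite nsubstE tsubst_tsubst; apply: tsubst_ext => Z _ /=.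
  by rewrite /setv; case: eqP.
exists g; split.
- split; [|split].
  + move=> Y; rewrite inE negb_or => /andP[Yx Yxs].
    by rewrite /g /setv (negbTE Yx) gV.
  + move=> X Y; rewrite !inE => Xx Yx; rewrite /g /setv; case: eqP Yx => [_ _|_ /= Yxs].
      rewrite occ_subst => -[Z]; rewrite occ_mu => -[_ Zx].
      have [Zxs|Zxs] := boolP (Z \in xs); last first.
        by rewrite gV//= => ZX; subst Z; case/orP: Xx => [/eqP//|]; exact/negP.
      by case/orP: Xx => [/eqP ->|]; [exact: gx|move=> Xxs; exact: gN].
    by case/orP: Xx => [/eqP ->|Xxs]; [exact: gx|exact: gN].
  + move=> X; rewrite inE => /predU1P[->|Xxs]; last first.
      rewrite gxs//; apply: eqv_trans (gE _ Xxs) _.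
      by rewrite /T' TE//; exact: eqv_refl.
    rewrite {1}/g /setv eqxx GE; apply: eqv_trans (eqv_unfold _ _) _.
    rewrite nsubstE tsubst_tsubst -GE -/g (_ : tsubst _ _ (T x) = tsubst Cst g (T x)).
      exact: eqv_refl.
    apply: tsubst_ext => Z _ /=; rewrite /g /setv.
    have [->|Zx] := eqVneq Z x; first by rewrite g'x /= eqxx.
    rewrite -[RHS]tsubst_Var; apply: tsubst_ext => Y Yo; case: eqP => // Yx; subst Y.
    have [/gx//|Zxs] := boolP (Z \in xs); rewrite gV//= in Yo.
    by rewrite Yo eqxx in Zx.
- have TO X Z : X \in xs -> occ Z (T' X) -> exists2 X, X \in x :: xs & occ Z (T X).
    move=> Xxs; rewrite /T' nsubstE occ_subst => -[Y Yo]; rewrite /setv.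
    case: eqP => [_|_ /= YZ]; last by subst Y; exists X => //; exact: inx.
    by rewrite occ_mu => -[Zo _]; exists x.
  have gO' Y Z : Y \in xs -> occ Z (g' Y) -> exists2 X, X \in x :: xs & occ Z (T X).
    by move=> Yxs /gO[//|X Xxs /TO]; exact.
  move=> Y Z; rewrite inE /g /setv; case: eqP => [_ _|_ /= Yxs]; last exact: gO'.
  rewrite occ_subst => -[X]; rewrite occ_mu => -[Xo _].
  have [/gO'|Xxs] := boolP (X \in xs); first exact.
  by rewrite gV//= => XZ; subst X; exists x.
move=> f [fV [fN fE]].
pose f' := setv f x (Var x).
have f'V Y : Y \notin xs -> f' Y = Var Y.
  move=> Yxs; rewrite /f' /setv; case: eqP => [->//|/eqP Yx].
  by rewrite fV// inE negb_or Yx.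
have f'x Y : Y != x -> ~ occ x (f' Y).
  move=> Yx; rewrite /f' /setv (negbTE Yx); have [Yxs|Yxs] := boolP (Y \in x :: xs).
    exact: fN.
  by rewrite fV//= => xY; rewrite xY eqxx in Yx.
have f'xE : f' x = Var x by rewrite /f' /setv eqxx.
(* With the other unknowns fixed by [f'], the first equation has the single unknown [x]. The values
   of [f'] at other names do not mention [x], so guardedness survives the substitution and (Fix)
   determines [f x]. *)
have fG : eqv (f x) (tsubst Cst f' G).
  rewrite tsubst_mu//; last by move=> Y _ /eqP; exact: f'x.
  apply: eqv_fix.
    apply: guarded_subst => Y; have [->|Yx] := eqVneq Y x; first by left; exact: gT.
    by right; apply: guarded_nocc; exact: f'x.
  apply: eqv_trans (fE _ xx) _.
  rewrite nsubstE tsubst_tsubst (_ : tsubst _ _ (T x) = tsubst Cst f (T x)).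
    exact: eqv_refl.
  apply: tsubst_ext => Z _ /=; have [->|Zx] := eqVneq Z x.
    by rewrite f'xE /= /setv eqxx.
  rewrite (_ : f Z = f' Z); last by rewrite /f' /setv (negbTE Zx).
  rewrite -[RHS]tsubst_Var; apply: tsubst_ext => X Xo; rewrite /setv.
  by case: eqP => // Xx; subst X; case: (f'x _ Zx).
have f'S : solves xs T' f'.
  split => //; split.
    move=> X Y Xxs Yxs; rewrite /f' /setv (negbTE (nx _ Yxs)).
    by apply: fN; exact: inx.
  move=> X Xxs; rewrite {1}/f' /setv (negbTE (nx _ Xxs)).
  apply: eqv_trans (fE _ (inx _ Xxs)) _; rewrite /T' TE//.
  apply: eqv_subst => Z _; rewrite /setv; case: eqP => [->//|/eqP Zx].
  by rewrite /f' /setv (negbTE Zx); exact: eqv_refl.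
have fg' X : X \in xs -> eqv (f' X) (g' X) by exact: gU.
move=> X; rewrite inE => /predU1P[->|Xxs]; last first.
  by rewrite gxs//; move: (fg' _ Xxs); rewrite /f' /setv (negbTE (nx _ Xxs)).
rewrite /g /setv eqxx; apply: eqv_trans fG _; apply: eqv_subst => Z _.
have [/fg'//|Zxs] := boolP (Z \in xs).
by rewrite gV// f'V//; exact: eqv_refl.
Qed.

End Systems.

(** * The universal chain *)

Section Transitions.
Context {R : realType} {L : Type}.

Definition ppush {K J} (c : R) (g : K -> option J) (l : seq (R * K)) : seq (R * J) :=
  pmap (fun x => omap (pair (c * x.1)) (g x.2)) l.

Lemma Ex_ppush K J c (g : K -> option J) l (phi : J -> R) :
  Ex (ppush c g l) phi = c * Ex l (fun k => if g k is Some j then phi j else 0).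
Proof.
elim: l => [|[p k] l IH] /=; first by rewrite !Ex_nil mulr0.
rewrite /ppush/= -/(ppush c g l) Ex_cons; case: (g k) => [j|] /=.
  by rewrite Ex_cons IH mulrDr mulrA.
by rewrite IH mulr0 add0r.
Qed.

Lemma nonneg_ppush K J c (g : K -> option J) l :
  0 <= c -> nonneg l -> nonneg (ppush c g l).
Proof.
move=> c0; elim: l => [//|[p k] l IH] /= /andP[p0 /IH l0].
by rewrite /ppush/= -/(ppush c g l); case: (g k) => //= j; rewrite mulr_ge0.
Qed.

Definition leaf {N : Type} (x : L * term R L void (option N) + option N) : R :=
  if x is inr None then 1 else 0.

Definition unrolled {N : Type} (s : term R L void N)
    (x : L * term R L void (option N) + option N) : option (L * term R L void N + N) :=
  match x with
  | inl p => Some (inl (p.1, inst s p.2))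
  | inr (Some X) => Some (inr X)
  | inr None => None
  end.

(* If the recursion variable has
   mass [c] in [b], then the transitions of [Rec b] are the other transitions of
   [b], rescaled by [(1 - c)^-1] ([0] if [c = 1]). *)
Fixpoint trans {N : Type} (t : term R L void N) : seq (R * (L * term R L void N + N)) :=
  match t with
  | Cst v => match v with end
  | Var X => [:: (1, inr X)]
  | Pre a u => [:: (1, inl (a, u))]
  | Sum e u u' => push e%:num id (trans u) ++ push (1 - e%:num) id (trans u')
  | Rec b => ppush (1 - Ex (trans b) leaf)^-1 (unrolled (Rec b)) (trans b)
  end.

Definition branch {N : Type} (A : Type) (phi : L -> term R L void N -> A) (psi : N -> A)
    (x : L * term R L void N + N) : A :=
  match x with inl p => phi p.1 p.2 | inr X => psi X end.

Lemma Ex_trans_Rec N b (phi : L * term R L void N + N -> R) :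
  Ex (trans (Rec b)) phi = (1 - Ex (trans b) leaf)^-1 * Ex (trans b)
    (branch (fun a u => phi (inl (a, inst (Rec b) u))) (bcons 0 (phi \o inr))).
Proof.
by rewrite /= Ex_ppush; congr (_ * _); apply: Ex_ext => -[[a u]|[X|]].
Qed.

Lemma Ex_trans_ren N (t : term R L void N) N' (f : N -> N') phi :
  Ex (trans (ren f t)) phi =
  Ex (trans t) (branch (fun a u => phi (inl (a, ren f u))) (phi \o inr \o f)).
Proof.
elim: t N' f phi => {N} [N []|N X|N a t IH|N e t IHt s IHs|N b IH] N' f phi.
- by rewrite /= !Ex_cons !Ex_nil.
- by rewrite /= !Ex_cons !Ex_nil.
- by rewrite /= !Ex_cat !Ex_push IHt IHs.
rewrite Ex_trans_Rec -/(ren f (Rec b)) Ex_trans_Rec !IH; congr ((1 - _)^-1 * _).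
  by apply: Ex_ext => -[[a u]|[X|]].
apply: Ex_ext => -[[a u]|[X|]] //=; congr (phi (inl (_, _))).
rewrite /inst tsubst_ren ren_tsubst; congr (tsubst _ _ _).
by apply/funext => -[].
Qed.

(** The mass that [t] puts on a free name is redistributed along the transitions of the term
    substituted for it. Working with integrals makes the order and grouping of the listed points
    irrelevant. *)
Lemma Ex_trans_subst N (t : term R L void N) N' (f : N -> term R L void N') phi :
  Ex (trans (tsubst Cst f t)) phi =
  Ex (trans t) (branch (fun a u => phi (inl (a, tsubst Cst f u)))
                       (fun Z => Ex (trans (f Z)) phi)).
Proof.
elim: t N' f phi => {N} [N []|N X|N a t IH|N e t IHt s IHs|N b IH] N' f phi.
- by rewrite /= Ex_cons Ex_nil addr0 mul1r.
- by rewrite /= !Ex_cons !Ex_nil.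
- by rewrite /= !Ex_cat !Ex_push IHt IHs.
rewrite tsubst_Rec Ex_trans_Rec !IH -tsubst_Rec Ex_trans_Rec; congr ((1 - _)^-1 * _).
  apply: Ex_ext => -[[a u]|[X|]] //=; last by rewrite Ex_cons Ex_nil mulr1 addr0.
  rewrite Ex_trans_ren (_ : branch _ _ = fun=> 0 * 0); first by rewrite ExZ mul0r.
  by apply/funext => -[[a u]|Y] /=; rewrite mul0r.
apply: Ex_ext => -[[a u]|[X|]] /=.
- by rewrite inst_up tsubst_inst.
- rewrite Ex_trans_ren; apply: Ex_ext => -[[a u]|Y] //=.
  by rewrite inst_ren_Some.
- by rewrite Ex_cons Ex_nil /= mulr0 addr0.
Qed.

Lemma trans_subproba N (t : term R L void N) : nonneg (trans t) /\ tot (trans t) <= 1.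
Proof.
elim: t => {N} [N []|N X|N a t _|N e t [t0 t1] s [s0 s1]|N b [b0 b1]].
- by rewrite /= /tot Ex_cons Ex_nil ler01 addr0 mul1r.
- by rewrite /= /tot Ex_cons Ex_nil ler01 addr0 mul1r.
- have e0 : 0 <= e%:num by [].
  have e1 : 0 <= 1 - e%:num by rewrite subr_ge0.
  split; first by rewrite /= /nonneg all_cat [all _ _]nonneg_push//= [all _ _]nonneg_push.
  rewrite /= /tot Ex_cat !Ex_push -/(tot _) -[Ex (trans s) _]/(tot (trans s)).
  by apply: le_trans (lerD (ler_wpM2l e0 t1) (ler_wpM2l e1 s1)) _; rewrite !mulr1 addrC subrK.
have leaf_le : Ex (trans b) leaf <= tot (trans b).
  by apply: Ex_le => // -[[a u]|[X|]] //=.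
have c1 : 0 <= 1 - Ex (trans b) leaf by rewrite subr_ge0 (le_trans leaf_le).
split; first by apply: nonneg_ppush; rewrite ?invr_ge0.
rewrite /tot Ex_trans_Rec.
move: c1; rewrite le_eqVlt => /predU1P[<-|c1]; first by rewrite invr0 mul0r.
rewrite mulrC ler_pdivrMr// mul1r lerBrDr -ExD; apply: le_trans b1.
by rewrite le_eqVlt; apply/orP; left; apply/eqP; apply: Ex_ext => -[[a u]|[X|]] /=;
  rewrite ?addr0 ?add0r.
Qed.

Lemma trans_nonneg N (t : term R L void N) : nonneg (trans t).
Proof. exact: (trans_subproba t).1. Qed.

Lemma leaf_le1 N (b : term R L void (option N)) : Ex (trans b) leaf <= 1.
Proof.
have [b0 b1] := trans_subproba b.
by apply: le_trans b1; apply: Ex_le => // -[[a u]|[X|]] //=.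
Qed.

(** With [c] the mass of the recursion variable and [A'] the contribution of the other transitions,
    the value [x] of the recursion must satisfy [x = A' + c * x]; the factor [(1 - c)^-1] is the
    geometric series solving this. *)
Lemma Ex_trans_unfold N (b : term R L void (option N)) phi :
  Ex (trans (Rec b)) phi = Ex (trans (inst (Rec b) b)) phi.
Proof.
rewrite [inst _ _]/inst Ex_trans_subst; set c := Ex (trans b) leaf.
pose A' := branch (fun a u => phi (inl (a, inst (Rec b) u))) (bcons 0 (phi \o inr)).
transitivity (Ex (trans b) A' + c * Ex (trans (Rec b)) phi); last first.
  rewrite /c mulrC -ExZ -ExD; apply: Ex_ext => -[[a u]|[X|]] /=.
  - by rewrite mulr0 addr0.
  - by rewrite Ex_cons Ex_nil mul1r mulr0.
  - by rewrite add0r mulr1.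
rewrite Ex_trans_Rec -/A' -/c.
have [c1|c1] := eqVneq c 1; last first.
  have c10 : 1 - c != 0 by rewrite subr_eq0 eq_sym.
  by field.
(* For [c = 1] the convention on the inverse of 0 makes the left side 0. The other side vanishes
   too: the total is at most 1, so no mass remains off the leaf. *)
rewrite c1 subrr invr0 !mul0r mul1r addr0.
apply/esym; apply: (Ex_eq0 (psi := fun x => 1 - leaf x)) (trans_nonneg b) _ _ _.
- by move=> [[a u]|[X|]] /=; rewrite ?subr0 ?subrr.
- have : Ex (trans b) (fun x => 1 - leaf x) = tot (trans b) - c.
    by rewrite ExD /c -[- Ex _ _]mulN1r -ExZ; congr (_ + _); apply: Ex_ext => x; rewrite mulN1r.
  move=> h; apply/le_anti; rewrite {1}h c1 subr_le0 (trans_subproba b).2 /=.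
  apply: Ex_ge0 (trans_nonneg b) _ => -[[a u]|[X|]] /=; rewrite ?subr0 ?subrr//.
- move=> [[a u]|[X|]] //= /eqP; by rewrite subr0 oner_eq0.
Qed.

(** Collects a finite superset of the terms reachable from [t]: unrolling [Rec b] affects the
    derivatives of the open body [b] only through one fixed substitution. *)
Fixpoint derivatives {N : Type} (t : term R L void N) : seq (term R L void N) :=
  t :: match t with
  | Cst v => [::]
  | Var X => [::]
  | Pre a u => derivatives u
  | Sum e u u' => derivatives u ++ derivatives u'
  | Rec b => map (inst (Rec b)) (derivatives b)
  end.

Lemma In_derivatives N (t : term R L void N) : List.In t (derivatives t).
Proof. by case: t => *; left. Qed.

Definition outside {N : Type} (A : seq (term R L void N)) : L * term R L void N + N -> R :=
  branch (fun=> fun u => (~~ `[< List.In u A >])%:R) (fun=> 0).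

(** Only transitions of positive weight have to stay in [A]; the lists may also contain targets of
    weight 0. *)
Definition closed_terms {N : Type} (A : seq (term R L void N)) :=
  forall u, List.In u A -> Ex (trans u) (outside A) = 0.

Lemma outside_ge0 N (A : seq (term R L void N)) x : 0 <= outside A x.
Proof. by case: x => [[a u]|X] /=. Qed.

Lemma outside_sub N (A B : seq (term R L void N)) (t : term R L void N) :
  (forall u, List.In u A -> List.In u B) ->
  Ex (trans t) (outside A) = 0 -> Ex (trans t) (outside B) = 0.
Proof.
move=> AB t0; apply: Ex_eq0 (trans_nonneg t) (outside_ge0 A) t0 _.
move=> [[a u]|X] //=; case: asboolP => //= [/AB uB _|_ /eqP].
  by case: asboolP.
by rewrite oner_eq0.
Qed.

Lemma derivatives_closed N (t : term R L void N) : closed_terms (derivatives t).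
Proof.
elim: t => {N} [N []|N X|N a t IH|N e t IHt s IHs|N b IH] u.
- by move=> /= [<-|//]; rewrite /= Ex_cons Ex_nil mulr0 addr0.
- move=> /= [<-|ut].
    rewrite /= Ex_cons Ex_nil addr0 mul1r /=.
    by case: asboolP => // -[]; right; exact: In_derivatives.
  by apply: outside_sub (IH _ ut) => v; right.
- have tS : forall v, List.In v (derivatives t) -> List.In v (derivatives (Sum e t s)).
    by move=> v vt; right; apply/List.in_app_iff; left.
  have sS : forall v, List.In v (derivatives s) -> List.In v (derivatives (Sum e t s)).
    by move=> v vt; right; apply/List.in_app_iff; right.
  move=> [<-|/List.in_app_iff[/IHt ut|/IHs us]].
  + rewrite [trans _]/= Ex_cat !Ex_push.
    rewrite (outside_sub tS (IHt _ (In_derivatives t))).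
    by rewrite (outside_sub sS (IHs _ (In_derivatives s))) !mulr0 addr0.
  + exact: outside_sub ut.
  + exact: outside_sub us.
have bR v : List.In v (derivatives b) -> List.In (inst (Rec b) v) (derivatives (Rec b)).
  by move=> vb; right; apply: List.in_map.
have Rb0 : Ex (trans (Rec b)) (outside (derivatives (Rec b))) = 0.
  rewrite Ex_trans_Rec (_ : Ex _ (branch _ _) = 0) ?mulr0//.
  apply: Ex_eq0 (trans_nonneg b) (outside_ge0 (derivatives b)) (IH _ (In_derivatives b)) _.
  move=> [[a v]|[X|]] //=; case: asboolP => //= [/bR vb _|_ /eqP].
    by case: asboolP.
  by rewrite oner_eq0.
move=> [<-//|/List.in_map_iff[v [<- vb]]].
(* A transition of the instance comes from [v], or passes through the recursion variable and is then
   a transition of [Rec b], which [Rb0] covers. *)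
rewrite {1}/inst Ex_trans_subst.
apply: Ex_eq0 (trans_nonneg v) (outside_ge0 (derivatives b)) (IH _ vb) _.
move=> [[a w]|[X|]] //=.
- case: asboolP => //= [/bR wb _|_ /eqP]; last by rewrite oner_eq0.
  by case: asboolP.
- by rewrite Ex_cons Ex_nil mulr0 addr0.
Qed.

End Transitions.

(** * Transition lists as the least solution of the chain equations *)

Section UniversalChain.
Context {R : realType} {L N : choiceType}.
Hypothesis infN : infinite_set [set: N].

Lemma mass_trans_chain : chain_eqs (fun (t : term R L void N) x => mass (trans t) x).
Proof.
split; [|split; [|split; [|split]]].
- move=> t x; rewrite mass_ge0 ?trans_nonneg//=.
  apply: le_trans (trans_subproba t).2; apply: Ex_le (trans_nonneg t) _ => j.
  by case: eqP.
- by move=> X x; rewrite /mass /= Ex_cons Ex_nil addr0 mul1r eq_sym.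
- by move=> a t x; rewrite /mass /= Ex_cons Ex_nil addr0 mul1r eq_sym.
- by move=> e t s x; rewrite /mass /= Ex_cat !Ex_push.
move=> X t; apply/funext => x; rewrite /mass {1}mu_def Ex_trans_unfold.
congr (Ex (trans _) _); rewrite /inst tsubst_ren; congr (tsubst _ _ _).
by apply/funext => Y /=; case: eqP.
Qed.

(** To pass under binders, the bound is proved for open terms [u] under a substitution [f], names
    contributing the [g]-value of their image. At a recursion the value [y] of [g] satisfies
    [A + c * y <= y], hence [A / (1 - c) <= y]; for [c = 1] the left side is 0 by convention. *)
Lemma mass_trans_least (g : term R L void N -> succ R L N -> R) : chain_eqs g ->
  forall t x, mass (trans t) x <= g t x.
Proof.
move=> [g01 [gVar [gPre [gSum gmu]]]] t x.
have gRec (b : term R L void (option N)) : g (Rec b) = g (inst (Rec b) b).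
  have [X [nX _]] := fresh_name infN (Rec b) (Rec b) (fun _ _ => id) (fun _ _ => id).
  by rewrite -[in RHS](nsubst_inst _ nX) (Rec_mu nX) gmu.
have key M (u : term R L void M) (f : M -> term R L void N) :
  Ex (trans u) (branch (fun a v => (inl (a, tsubst Cst f v) == x)%:R) (g^~ x \o f))
    <= g (tsubst Cst f u) x.
  elim: u f => {M} [M []|M X|M a u IH|M e u IHu s IHs|M b IH] f.
  - by rewrite /= Ex_cons Ex_nil addr0 mul1r.
  - by rewrite /= Ex_cons Ex_nil addr0 mul1r gPre eq_sym.
  - rewrite /= gSum Ex_cat !Ex_push lerD// ler_wpM2l// ?subr_ge0//.
      exact: IHu.
    exact: IHs.
  rewrite Ex_trans_Rec; set c := Ex _ leaf; set A := Ex _ _.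
  have := IH (bcons (tsubst Cst f (Rec b)) f).
  rewrite -inst_up tsubst_Rec -gRec -tsubst_Rec.
  rewrite (_ : Ex _ _ = A + c * g (tsubst Cst f (Rec b)) x); last first.
    rewrite /c /A mulrC -ExZ -ExD; apply: Ex_ext => -[[a u]|[X|]] /=.
    + by rewrite mulr0 addr0 tsubst_inst.
    + by rewrite mulr0 addr0.
    + by rewrite mulr1 add0r.
  have := leaf_le1 b; rewrite -/c le_eqVlt => /predU1P[-> _|c1 h].
    by rewrite subrr invr0 mul0r; case/andP: (g01 (tsubst Cst f (Rec b)) x).
  by rewrite mulrC ler_pdivrMr ?subr_gt0// mulrBr mulr1 lerBrDr (mulrC _ c).
rewrite -[t in g t](tsubst_Var t); apply: le_trans (key _ t Var).
apply: Ex_le (trans_nonneg t) _ => -[[a u]|X] /=; rewrite ?tsubst_Var//.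
by rewrite gVar eq_sym.
Qed.

Lemma least_funP (A B : Type) (P : set (A -> B -> R)) f :
  P f -> (forall g, P g -> forall x y, f x y <= g x y) -> least_fun P = f.
Proof.
move=> Pf fP; rewrite /least_fun; case: xgetP => [h _ [Ph hP]|/(_ f)[]//].
by apply/funext => x; apply/funext => y; apply/le_anti; rewrite hP// fP.
Qed.

Lemma universal_chainE (t : term R L void N) : universal_chain t = mass (trans t).
Proof.
by rewrite /universal_chain (least_funP mass_trans_chain mass_trans_least).
Qed.

End UniversalChain.

(** * Expansion into transitions *)

Section Embedding.
Context {R : realType} {L W : Type}.

Lemma embed_Rec N (b : term R L void (option N)) : embed W (Rec b) = Rec (embed W b).
Proof.
by congr Rec; congr (tsubst _ _ _); apply/funext => -[].
Qed.

Lemma embed_subst N N' (f : N -> term R L void N') (t : term R L void N) :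
  embed W (tsubst Cst f t) = tsubst Cst (fun X => embed W (f X)) (embed W t).
Proof.
by rewrite /embed /csubst !tsubst_tsubst; congr (tsubst _ _ _); apply/funext => -[].
Qed.

Lemma embed_mu (N : eqType) X (t : term R L void N) : embed W (mu X t) = mu X (embed W t).
Proof.
by rewrite !mu_def embed_Rec !ren_subst embed_subst.
Qed.

Lemma occ_embed N X (t : term R L void N) : occ X (embed W t) -> occ X t.
Proof.
elim: t X => {N} [N []|//|N a t IH|N e t IHt s IHs|N b IH] X.
- exact: IH.
- by move=> [/IHt|/IHs]; [left|right].
- by rewrite embed_Rec => /IH.
Qed.

End Embedding.

Section Expansion.
Context {R : realType} {L W N : choiceType} {lambda : R}.
Hypothesis infN : infinite_set [set: N].
Local Notation eqv := (@eqv R L W N lambda).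
Local Notation bot := (@bot R L W N).

Lemma tsubst_csum K (h : K -> term R L W N) l (f : N -> term R L W N) :
  tsubst Cst f (csum h l) = csum (tsubst Cst f \o h) l.
Proof. by elim: l => [//|[p k] l IH] /=; rewrite IH. Qed.

Lemma guarded_csum K (h : K -> term R L W N) l X :
  (forall x, List.In x l -> guarded X (h x.2)) -> guarded X (csum h l).
Proof.
elim: l => [//|[p k] l IH] /= hX; split; right; first by apply: (hX (p, k)); left.
by apply: IH => x xl; apply: hX; right.
Qed.

Lemma csum_point K (h : K -> term R L W N) p k l : 0 < p -> tot l = 0 ->
  eqv (csum h ((p, k) :: l)) (h k).
Proof. by move=> p0 l0; rewrite csum_cons l0; exact: mix1. Qed.

(* The transitions of [t] completed to a probability distribution; [None] is the
   divergence state [bot]. *)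
Definition full (t : term R L void N) : seq (R * option (succ R L N)) :=
  push 1 Some (trans t) ++ [:: (1 - tot (trans t), None)].

Lemma Ex_full t phi :
  Ex (full t) phi = Ex (trans t) (phi \o Some) + (1 - tot (trans t)) * phi None.
Proof. by rewrite Ex_cat Ex_push mul1r Ex_cons Ex_nil addr0. Qed.

Lemma full_nonneg t : nonneg (full t).
Proof.
have [t0 t1] := trans_subproba t.
by rewrite /nonneg all_cat [all _ _]nonneg_push//= subr_ge0 t1.
Qed.

Lemma tot_full t : tot (full t) = 1.
Proof. by rewrite /tot Ex_full mulr1 addrC subrK. Qed.

Definition interp (k : option (succ R L N)) : term R L W N :=
  if k is Some x then branch (fun a u => Pre a (embed W u)) Var x else bot.

Lemma mu_Var X : mu X (Var X) = bot.
Proof. by rewrite mu_def /= eqxx. Qed.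

Definition subst_key X (s : term R L void N) (k : option (succ R L N)) :=
  if k is Some (inl (a, u)) then Some (inl (a, nsubst u X s)) else k.

Lemma interp_subst X s k : k <> Some (inr X) ->
  interp (subst_key X s k) = nsubst (interp k) X (embed W s).
Proof.
case: k => [[[a u]|Y]|] //= kX.
  rewrite /= nsubstE nsubstE embed_subst /=; congr Pre; congr (tsubst _ _ _).
  by apply/funext => Y; rewrite /setv /=; case: eqP.
by rewrite /setv /= nsubstE /= /setv; case: eqP => // YX; rewrite YX in kX.
Qed.

Lemma Ex_trans_mu X (t : term R L void N) phi :
  Ex (trans (mu X t)) phi = (1 - mass (trans t) (inr X))^-1 *
    Ex (trans t) (branch (fun a u => phi (inl (a, nsubst u X (mu X t))))
                         (fun Y => if Y == X then 0 else phi (inr Y))).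
Proof.
rewrite mu_def Ex_trans_Rec !Ex_trans_ren; congr ((1 - _)^-1 * _); apply: Ex_ext.
  move=> [[a u]|Y] //=; case: eqP => [->|YX]; first by rewrite eqxx.
  by case: eqP => // -[].
move=> [[a u]|Y] /=; last by case: eqP.
rewrite /inst tsubst_ren; congr (phi (inl (_, tsubst _ _ _))).
by apply/funext => Y /=; rewrite /setv; case: eqP.
Qed.

(** The delicate case is [mu X t]. The mass [c] that [t] puts on the unguarded [X] is collected in
    one summand and erased by (Unguard), after which one (Unfold) replaces [X] below the prefixes.
    [csum] renormalises the remaining weights, which reproduces the factor [(1 - c)^-1] in the
    transitions of a recursion. *)
Theorem expansion t : eqv (embed W t) (csum interp (full t)).
Proof.
elim/(@named_ind R L void N infN): t => [[]|X|a t _|e t s IHt IHs|X t IH].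
- apply: eqv_sym; apply: csum_point; rewrite ?mulr1//.
  by rewrite /tot !Ex_cons !Ex_nil !addr0 !mulr1 subrr.
- apply: eqv_sym; apply: csum_point; rewrite ?mulr1//.
  by rewrite /tot !Ex_cons !Ex_nil !addr0 !mulr1 subrr.
- have e0 : 0 <= e%:num by [].
  have e1 : 0 <= 1 - e%:num by rewrite subr_ge0.
  have ee : e%:num + (1 - e%:num) = 1 by rewrite addrC subrK.
  have totE c u : tot (push c id (full u)) = c.
    by rewrite /tot Ex_push -/(tot _) tot_full mulr1.
  have pushE c u : 0 <= c -> 0 < c -> eqv (embed W u) (csum interp (full u)) ->
      eqv (embed W u) (csum interp (push c id (full u))).
    by move=> _ c0; rewrite csum_push.
  apply: (@eqv_trans _ _ _ _ _ (csum interp (push e%:num id (full t) ++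
      push (1 - e%:num) id (full s)))); last first.
    apply: csum_mass; rewrite ?full_nonneg//.
    + by rewrite /nonneg all_cat [all _ _]nonneg_push ?full_nonneg// [all _ _]nonneg_push ?full_nonneg.
    + by rewrite /tot Ex_cat -/(tot _) -[Ex (push (1 - _) _ _) _]/(tot _) !totE ee.
    + move=> k; rewrite /mass Ex_cat !Ex_push !Ex_full /= Ex_cat !Ex_push /tot.
      rewrite Ex_cat !Ex_push -/(tot (trans t)) -[Ex (trans s) (fun=> 1)]/(tot (trans s)).
      by rewrite /comp; ring.
  apply: eqv_trans; last first.
    apply: eqv_sym; apply: csum_cat; rewrite ?nonneg_push ?full_nonneg//.
    by rewrite !totE ee.
  have mixE : mix e%:num (embed W t) (1 - e%:num) (embed W s) = embed W (Sum e t s).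
    rewrite /mix ee divr1; congr (Sum _ _ _); apply: val_inj.
    by rewrite [LHS]clipE// e0 -subr_ge0.
  by rewrite !totE -mixE; apply: eqv_mix; rewrite ?ee// => c0; exact: pushE.
have f0 := full_nonneg t; set k0 : option (succ R L N) := Some (inr X).
set c := mass (full t) k0; set r := tot (others k0 (full t)).
have c0 : 0 <= c by exact: mass_ge0.
have r0 : 0 <= r by exact/tot_ge0/nonneg_others.
have cE : mass (trans t) (inr X) = c by rewrite /c /mass Ex_full /= mulr0 addr0.
have cr : c + r = 1.
  by rewrite -(tot_full t) [RHS](Ex_others _ k0) mulr1.
have tE : eqv (embed W t) (mix c (Var X) r (csum interp (others k0 (full t)))).
  by apply: eqv_trans IH (csum_others interp k0 f0 _); rewrite tot_full.
rewrite embed_mu; move: r0; rewrite le_eqVlt => /predU1P[r0|r0].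
  rewrite -r0 addr0 in cr; rewrite -r0 cr in tE.
  have tot0 : tot (trans (mu X t)) = 0.
    by rewrite /tot Ex_trans_mu cE cr subrr invr0 mul0r.
  apply: (@eqv_trans _ _ _ _ _ bot).
    by rewrite -(mu_Var X); apply: eqv_mu; apply: eqv_trans tE _; exact: mix1.
  apply: (@eqv_trans _ _ _ _ _ (csum interp [:: (1, None)])).
    by apply: eqv_sym; apply: csum_point => //; rewrite /tot Ex_nil.
  apply: csum_mass => [|||k]; first by rewrite /= ler01.
  - exact: full_nonneg.
  - by rewrite /tot Ex_cons Ex_nil mulr1 addr0.
  rewrite /mass Ex_full Ex_cons Ex_nil tot0 subr0 addr0 Ex_trans_mu cE cr subrr.
  by rewrite invr0 mul0r add0r.
set s := mu X t; set rest := others k0 (full t).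
have rest0 : nonneg rest by exact: nonneg_others.
(* [mixC] moves [X] to the right summand, as (Unguard) demands; the clipped number is the weight of
   the left one. *)
have muE : eqv (mu X (embed W t)) (mu X (csum interp rest)).
  apply: eqv_trans (eqv_mu X _) (eqv_unguard X _ (clip (r / (r + c)))).
  by apply: eqv_trans tE _; apply: mixC; rewrite ?(ltW r0) ?cr.
apply: (eqv_trans muE); apply: eqv_trans (eqv_unfold _ _) _.
apply: (@eqv_trans _ _ _ _ _ (nsubst (csum interp rest) X (embed W s))).
  apply: (eqv_subst infN) => Y _; rewrite /setv; case: eqP => _; last exact: eqv_refl.
  by rewrite /s embed_mu; exact: eqv_sym.
rewrite nsubstE tsubst_csum.
apply: (@eqv_trans _ _ _ _ _ (csum (interp \o subst_key X s) rest)).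
  apply: eqv_csum => // -[p k] xr _ /=.
  rewrite interp_subst; first exact: eqv_refl.
  move=> kk; move: xr; rewrite kk /rest; elim: (full t) => //= -[q j] l IHl /=.
  by case: eqP => //= jk [[_ /jk]|].
rewrite -(csum_push _ _ (c := r^-1)) ?invr_gt0//.
have rV0 : 0 <= r^-1 by rewrite invr_ge0 ltW.
(* The comparison includes the divergence mass: [tot (trans s)] is [(tot (trans t) - c) / r] with
   [r = 1 - c], so [1 - tot (trans s)] is [(1 - tot (trans t)) / r]. *)
have Exr phi : Ex (push r^-1 (subst_key X s) rest) phi = Ex (full s) phi.
  rewrite Ex_push Ex_full.
  have -> : Ex rest (phi \o subst_key X s) =
      Ex (full t) (phi \o subst_key X s) - c * phi k0.
    by rewrite [Ex (full t) _](Ex_others _ k0) -/c addrC addKr.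
  have rE : r = 1 - c by rewrite -cr addrC addKr.
  have EE psi : Ex (trans s) psi =
      r^-1 * (Ex (trans t) (branch (fun a u => psi (inl (a, nsubst u X s))) (psi \o inr))
              - c * psi (inr X)).
    rewrite Ex_trans_mu cE -rE; congr (_ * _).
    apply: (addIr (c * psi (inr X))); rewrite subrK -cE /mass mulrC -ExZ -ExD.
    apply: Ex_ext => -[[a u]|Y] /=; first by rewrite mulr0 addr0.
    have [->|YX] := eqVneq Y X; first by rewrite eqxx mulr1 add0r.
    by rewrite (_ : (inr Y == inr X) = false) ?mulr0 ?addr0//; apply/eqP => -[/eqP]; exact/negP.
  have totE : tot (trans s) = r^-1 * (tot (trans t) - c).
    by rewrite /tot EE mulr1; congr (_ * (_ - _)); apply: Ex_ext => -[].
  have BE : Ex (trans t) ((phi \o subst_key X s) \o Some) = Ex (trans t) (branch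
      (fun a u => (phi \o Some) (inl (a, nsubst u X s))) ((phi \o Some) \o inr)).
    by apply: Ex_ext => -[[a u]|Y].
  rewrite Ex_full EE totE BE.
  have rn0 : r != 0 by rewrite gt_eqF.
  rewrite /= -/k0 (_ : c = 1 - r); last by rewrite -cr addrK.
  by field.
apply: csum_mass; rewrite ?full_nonneg ?nonneg_push//.
  by rewrite /tot Exr -/(tot _) tot_full.
by move=> k; exact: Exr.
Qed.

End Expansion.

(** * Bisimilarity *)

Section Bisimilarity.
Context {R : realType} {L W N : choiceType} {lambda : R}.
Hypothesis infN : infinite_set [set: N].
Local Notation eqv := (@eqv R L W N lambda).
Local Notation bot := (@bot R L W N).
Local Notation tm := (term R L void N).

Lemma In_mem (T : eqType) (x : T) (s : seq T) : List.In x s <-> x \in s.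
Proof.
elim: s => [//|y s IH]; rewrite inE /= IH; split=> [[->|->]|/predU1P[->|]].
- by rewrite eqxx.
- by rewrite orbT.
- by left.
- by right.
Qed.

Lemma Ex_eq0_In K (l : seq (R * K)) psi x : nonneg l -> (forall k, 0 <= psi k) ->
  Ex l psi = 0 -> List.In x l -> 0 < x.1 -> psi x.2 = 0.
Proof.
move=> + psi0; elim: l => [//|[p k] l IH] /= /andP[p0 l0]; rewrite Ex_cons => /eqP.
rewrite paddr_eq0 ?mulr_ge0 ?Ex_ge0// => /andP[/eqP pk /eqP El] [<- /= pp|xl]; last exact: IH.
by move/eqP: pk; rewrite mulf_eq0 gt_eqF//= => /eqP.
Qed.

Lemma fresh_list (F : set N) n : finite_set F ->
  exists xs : seq N, [/\ uniq xs, size xs = n & forall X, X \in xs -> ~ F X].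
Proof.
move=> fF; elim: n => [|n [xs [uxs <- xsF]]]; first by exists [::].
have [X [nF nX]] : exists X, ~ F X /\ X \notin xs.
  apply: contrapT => nex; apply: infN; apply: (@sub_finite_set _ _ (F `|` [set` xs])).
    move=> X _; apply: contrapT => /not_orP[nF /negP nX]; apply: nex; by exists X.
  by rewrite finite_setU; split => //; exact: finite_seq.
exists (X :: xs); split => //=; first by rewrite nX.
by move=> Y; rewrite inE => /predU1P[->//|/xsF].
Qed.

Definition names (A : seq tm) : set N := [set X | exists2 u, u \in A &
  occ X u \/ exists2 x, List.In x (full u) & x.2 = Some (inr X)].

Lemma names_finite A : finite_set (names A).
Proof.
elim: A => [|u A IH].
  by rewrite (_ : names [::] = set0)//; apply/seteqP; split => // X [].
have [F [fF hF]] := occ_finite u.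
have fG : finite_set [set X | exists2 x, List.In x (full u) & x.2 = Some (inr X)].
  elim: (full u) => [|[p k] l IHl].
    by rewrite (_ : [set _ | _] = set0)//; apply/seteqP; split => // X [].
  apply: (@sub_finite_set _ _ ((if k is Some (inr X) then [set X] else set0) `|`
    [set X | exists2 x, List.In x l & x.2 = Some (inr X)])).
    by move=> X [x /= [<- /= ->|xl xX]]; [left|right; exists x].
  rewrite finite_setU; split => //; by case: k => [[|]|].
apply: (@sub_finite_set _ _ (F `|` _ `|` names A)); last first.
  by rewrite !finite_setU; split; [split; [exact: fF|exact: fG]|].
move=> X [v]; rewrite inE => /predU1P[->|vA] h; last by right; exists v.
by left; case: h => [/hF|]; [left|right].
Qed.

(* A bisimulation is given by a choice [r] of representatives.  The quotient
   system has a solution [g] by [guarded_system]; both [embed] and [g] composed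
   with [r] solve the system of the transitions of the terms in [A], so that they
   agree by uniqueness. *)
Lemma bisimilar_eqv (A : seq tm) (r : tm -> tm) :
  closed_terms A -> (forall t, t \in A -> r t \in A) ->
  (forall t, t \in A -> r (r t) = r t) ->
  (forall t, t \in A -> forall phi, Ex (trans t) (branch (fun a u => phi (inl (a, r u))) (phi \o inr)) =
     Ex (trans (r t)) (branch (fun a u => phi (inl (a, r u))) (phi \o inr))) ->
  forall t, t \in A -> eqv (embed W t) (embed W (r t)).
Proof.
move=> clA rA rr bis.
have [xs [uxs szxs xsF]] := fresh_list (size (undup A)) (names_finite A).
move=> t0 t0A.
have [X0 _] : exists X0 : N, True.
  case: xs szxs {uxs xsF} => [|X xs _]; last by exists X.
  by move: t0A; rewrite -mem_undup; case: (undup A).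
pose name u := nth X0 xs (index u (undup A)).
pose st X := nth t0 (undup A) (index X xs).
have nameP u : u \in A -> name u \in xs.
  by move=> uA; rewrite mem_nth// szxs index_mem mem_undup.
have stP X : X \in xs -> st X \in A.
  by move=> Xxs; rewrite -mem_undup mem_nth// -szxs index_mem.
have stK u : u \in A -> st (name u) = u.
  by move=> uA; rewrite /st /name index_uniq ?nth_index ?mem_undup// szxs index_mem mem_undup.
have stepA u x a v : u \in A -> List.In x (full u) -> 0 < x.1 -> x.2 = Some (inl (a, v)) -> v \in A.
  move=> /In_mem/clA clu xu x0 xE.
  have := @Ex_eq0_In _ (full u) (fun k => if k is Some y then outside A y else 0) x
    (full_nonneg u) _ _ xu x0.
  rewrite xE /= => h; apply/In_mem; apply: contrapT => nv.
  have /eqP : (~~ `[< List.In v A >])%:R = 0 :> R.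
    apply: h; first by case=> [y|] //; exact: outside_ge0.
    by rewrite Ex_full mulr0 addr0.
  by case: asboolP => //= _; rewrite oner_eq0.
have freshA u x Y : u \in A -> List.In x (full u) -> x.2 = Some (inr Y) -> Y \notin xs.
  move=> uA xu xY; apply/negP => /xsF; apply; exists u => //; right; by exists x.
pose key (c : tm -> term R L W N) (k : option (succ R L N)) : term R L W N :=
  if k is Some x then branch (fun a u => Pre a (c u)) Var x else bot.
(* One construction yields two systems: for [rho = id] a state refers to its successors, for
   [rho = r] to their representatives. *)
pose T (rho : tm -> tm) u := csum (key (Var \o name \o rho)) (full u).
have gT rho u X : u \in A -> X \in xs -> guarded X (T rho u).
  move=> uA Xxs; apply: guarded_csum => -[p [[[a v]|Y]|]] //= xu YX.
  by have := freshA _ _ Y uA xu erefl; rewrite YX Xxs.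
have substT rho u f : u \in A -> (forall Y, Y \notin xs -> f Y = Var Y) ->
    eqv (tsubst Cst f (T rho u)) (csum (key (f \o name \o rho)) (full u)).
  move=> uA fV; rewrite /T tsubst_csum; apply: eqv_csum; rewrite ?full_nonneg ?tot_full//.
  move=> [p [[[a v]|Y]|]] xu p0 /=; try exact: eqv_refl.
  by rewrite fV; [exact: eqv_refl|exact: (freshA _ _ _ uA xu)].
have [|g [[gV [gN gE]] _ _]] := @guarded_system _ _ _ _ lambda infN xs (fun X => T r (r (st X))) uxs.
  by move=> X Y Xxs Yxs; apply: gT => //; apply: rA; exact: stP.
have [|g2 [_ _ gU]] := @guarded_system _ _ _ _ lambda infN xs (fun X => T id (st X)) uxs.
  by move=> X Y Xxs Yxs; apply: gT => //; exact: stP.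
pose f1 X := if X \in xs then embed W (st X) else Var X.
pose f2 X := if X \in xs then g (name (r (st X))) else Var X.
have f1V Y : Y \notin xs -> f1 Y = Var Y by rewrite /f1 => /negbTE ->.
have f2V Y : Y \notin xs -> f2 Y = Var Y by rewrite /f2 => /negbTE ->.
have S1 : @solves R L W N lambda xs (fun X => T id (st X)) f1.
  split => //; split.
    move=> X Y Xxs Yxs; rewrite /f1 Yxs => h; have {h}Xo := occ_embed h.
    by apply: (xsF X Xxs); exists (st Y); [exact: stP|left].
  move=> X Xxs; apply: (eqv_trans _ (eqv_sym (substT _ _ _ (stP _ Xxs) f1V))).
  rewrite {1}/f1 Xxs; apply: eqv_trans (expansion infN _) _.
  apply: eqv_csum; rewrite ?full_nonneg ?tot_full//.
  move=> [p [[[a v]|Y]|]] xu p0 /=; try exact: eqv_refl.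
  have vA := stepA _ _ _ _ (stP _ Xxs) xu p0 erefl.
  by rewrite /f1 nameP// stK//; exact: eqv_refl.
have S2 : @solves R L W N lambda xs (fun X => T id (st X)) f2.
  split => //; split.
    move=> X Y Xxs Yxs; rewrite /f2 Yxs; apply: gN => //.
    by apply/nameP/rA/stP.
  move=> X Xxs; apply: (eqv_trans _ (eqv_sym (substT _ _ _ (stP _ Xxs) f2V))).
  have uA := stP _ Xxs; have ruA := rA _ uA.
  rewrite {1}/f2 Xxs; apply: eqv_trans (gE _ (nameP _ ruA)) _.
  rewrite stK// rr//; apply: eqv_trans (substT _ _ _ ruA gV) _.
  pose rk (k : option (succ R L N)) := if k is Some (inl (a, u)) then Some (inl (a, r u)) else k.
  apply: (@eqv_trans _ _ _ _ _ (csum (key (g \o name)) (push 1 rk (full (r (st X)))))).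
    rewrite csum_push// (_ : key (g \o name \o r) = key (g \o name) \o rk); first exact: eqv_refl.
    by apply/funext => -[[[a u]|Y]|].
  (* The bisimulation hypothesis replaces the transitions of the representative by those of [st X];
     this is possible after [rk], which identifies successors with a common representative. *)
  apply: (@eqv_trans _ _ _ _ _ (csum (key (g \o name)) (push 1 rk (full (st X))))).
    apply: csum_mass; rewrite ?nonneg_push ?full_nonneg//.
      by rewrite /tot Ex_push mul1r -/(tot _) tot_full.
    have brE u (phi : option (succ R L N) -> R) : Ex (trans u) (phi \o rk \o Some) =
        Ex (trans u) (branch (fun a v => (phi \o Some) (inl (a, r v))) ((phi \o Some) \o inr)).
      by apply: Ex_ext => -[[a v]|Y].
    have totE : tot (trans (r (st X))) = tot (trans (st X)).
      by have := bis _ uA (fun=> 1); rewrite /tot -!(brE _ (fun=> 1)).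
    move=> k; rewrite /mass !Ex_push !mul1r !Ex_full totE; congr (_ + _).
    by rewrite !brE (bis _ uA).
  rewrite csum_push//; apply: eqv_csum; rewrite ?full_nonneg ?tot_full//.
  move=> [p [[[a v]|Y]|]] xu p0 /=; try exact: eqv_refl.
  have vA := stepA _ _ _ _ (stP _ Xxs) xu p0 erefl.
  by rewrite /f2 nameP// stK//; exact: eqv_refl.
have fE u : u \in A -> eqv (embed W u) (g (name (r u))).
  move=> uA; have nu := nameP _ uA.
  have := eqv_trans (gU _ S1 _ nu) (eqv_sym (gU _ S2 _ nu)).
  by rewrite /f1 /f2 nu stK.
(* The solution provided by [fE] depends on a term only through its representative, and [r] is
   idempotent on [A]. *)
apply: eqv_trans (fE _ t0A) _; rewrite -{1}(rr _ t0A); apply: eqv_sym.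
by apply: fE; exact: rA.
Qed.

End Bisimilarity.

(** * The Kantorovich lifting and the discounted distance *)

Section Kantorovich.
Context {R : realType} {A : choiceType}.
Implicit Types (d : A -> A -> R) (m n : A -> R) (r : seq A) (w : A * A -> R).

Lemma fsumE (B : choiceType) (f : B -> R) (r : seq B) : uniq r ->
  (forall x, x \notin r -> f x = 0) -> \sum_(x \in [set: B]) f x = \sum_(x <- r) f x.
Proof.
move=> ur f0; rewrite (@fsbigE _ _ _ _ _ r)//; last by move=> x _; exact: f0.
by under eq_bigl do rewrite in_setT.
Qed.

Definition distr r m := [/\ uniq r, forall x, 0 <= m x,
  forall x, x \notin r -> m x = 0 & \sum_(x <- r) m x = 1].

Definition cost r d w : R := \sum_(x <- r) \sum_(y <- r) d x y * w (x, y).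

Definition fcoupling r m n w := [/\ forall p, 0 <= w p,
  forall x y, (x \notin r) || (y \notin r) -> w (x, y) = 0,
  forall x, \sum_(y <- r) w (x, y) = m x & forall y, \sum_(x <- r) w (x, y) = n y].

Lemma sum_allpairs (r : seq A) (f : A * A -> R) :
  \sum_(p <- [seq (x, y) | x <- r, y <- r]) f p = \sum_(x <- r) \sum_(y <- r) f (x, y).
Proof. exact: big_allpairs. Qed.

Lemma pairs_supp r w : (forall x y, (x \notin r) || (y \notin r) -> w (x, y) = 0) ->
  forall p, p \notin [seq (x, y) | x <- r, y <- r] -> w p = 0.
Proof.
move=> w0 [x y] xy; apply: w0; rewrite -negb_and; apply: contra xy => /andP[xr yr].
exact: allpairs_f.
Qed.

(** Each entry of a coupling is bounded by both marginals, so a coupling lives on pairs from [r].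
    The finite support of [w] turns the sums over the whole type into genuine finite sums, where
    these bounds are visible. *)
Lemma fcouplingP r m n w : distr r m -> distr r n -> coupling m n w <-> fcoupling r m n w.
Proof.
move=> [ur m0 mr _] [_ n0 nr _]; split=> [[w0 [fw [wm wn]]]|[w0 wr wm wn]]; last first.
  split => //; split; [|split].
  - apply: (@sub_finite_set _ _ [set` [seq (x, y) | x <- r, y <- r]]); last exact: finite_seq.
    move=> p /= wp; apply: contrapT => /negP /(pairs_supp wr) w'0.
    by rewrite w'0 eqxx in wp.
  - by move=> x; rewrite (@fsumE _ _ r)// => y yr; apply: wr; rewrite yr orbT.
  - by move=> y; rewrite (@fsumE _ _ r)// => x xr; apply: wr; rewrite xr.
have [s sE] := (finite_seqP _).1 fw.
have ws p : p \notin s -> w p = 0.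
  move=> ps; apply: contrapT => /eqP wp; move/negP: ps; apply.
  by have : [set p | w p != 0] p by []; rewrite sE.
have wmle x y : w (x, y) <= m x.
  pose t := undup [seq p.2 | p <- s].
  rewrite -wm (@fsumE _ _ t) ?undup_uniq//; last first.
    move=> z zt; apply: ws; apply: contra zt => zs.
    by rewrite mem_undup; apply/mapP; exists (x, z).
  have [yt|yt] := boolP (y \in t).
    by rewrite (bigD1_seq y) ?undup_uniq//= lerDl sumr_ge0.
  rewrite ws ?sumr_ge0//; apply: contra yt => zs.
  by rewrite mem_undup; apply/mapP; exists (x, y).
have wnle x y : w (x, y) <= n y.
  pose t := undup [seq p.1 | p <- s].
  rewrite -wn (@fsumE _ _ t) ?undup_uniq//; last first.
    move=> z zt; apply: ws; apply: contra zt => zs.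
    by rewrite mem_undup; apply/mapP; exists (z, y).
  have [yt|yt] := boolP (x \in t).
    by rewrite (bigD1_seq x) ?undup_uniq//= lerDl sumr_ge0.
  rewrite ws ?sumr_ge0//; apply: contra yt => zs.
  by rewrite mem_undup; apply/mapP; exists (x, y).
have wr x y : (x \notin r) || (y \notin r) -> w (x, y) = 0.
  move=> /orP[/mr xr|/nr yr]; apply/le_anti; rewrite w0 andbT.
    by rewrite -xr.
  by rewrite -yr.
split => //.
- by move=> x; rewrite -wm (@fsumE _ _ r)// => y yr; apply: wr; rewrite yr orbT.
- by move=> y; rewrite -wn (@fsumE _ _ r)// => x xr; apply: wr; rewrite xr.
Qed.

Lemma costE r d m n w : uniq r -> fcoupling r m n w ->
  \sum_(p \in [set: A * A]) d p.1 p.2 * w p = cost r d w.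
Proof.
move=> ur [w0 wr _ _]; rewrite (@fsumE _ _ [seq (x, y) | x <- r, y <- r]).
- by rewrite sum_allpairs.
- by apply: allpairs_uniq => // -[? ?] [? ?].
- by move=> p /(pairs_supp wr) ->; rewrite mulr0.
Qed.

Definition costs r d m n : set R := [set cost r d w | w in fcoupling r m n].

Lemma kantorovichE r d m n : distr r m -> distr r n ->
  kantorovich d m n = inf (costs r d m n).
Proof.
move=> mr nr; have [ur _ _ _] := mr.
congr inf; apply/seteqP; split => _ [w /= wc <-].
  by move/(fcouplingP _ mr nr): wc => wc; exists w; rewrite -?(costE d ur wc).
by exists w; [exact/(fcouplingP _ mr nr)|rewrite (costE d ur wc)].
Qed.

Lemma cost_le r d d' m n w : fcoupling r m n w -> (forall x y, d x y <= d' x y) ->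
  cost r d w <= cost r d' w.
Proof.
move=> [w0 _ _ _] dd'; apply: ler_sum => x _; apply: ler_sum => y _.
exact: ler_wpM2r.
Qed.

Lemma cost_cst r m n w (c : R) : distr r m -> fcoupling r m n w ->
  cost r (fun _ _ => c) w = c.
Proof.
move=> [_ _ _ m1] [_ _ wm _]; rewrite -[RHS]mulr1 -m1 mulr_sumr.
by apply: eq_bigr => x _; rewrite -mulr_sumr wm.
Qed.

Lemma fcoupling_prod r m n : distr r m -> distr r n ->
  fcoupling r m n (fun p => m p.1 * n p.2).
Proof.
move=> [_ m0 mr m1] [_ n0 nr n1]; split => [p|x y|x|y] /=.
- exact: mulr_ge0.
- by move=> /orP[/mr ->|/nr ->]; rewrite ?mul0r ?mulr0.
- by rewrite -mulr_sumr n1 mulr1.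
- by rewrite -mulr_suml m1 mul1r.
Qed.

Lemma has_inf_costs r d m n : (forall x y, 0 <= d x y) -> distr r m -> distr r n ->
  has_inf (costs r d m n).
Proof.
move=> d0 mr nr; split.
  by exists (cost r d (fun p => m p.1 * n p.2)), (fun p => m p.1 * n p.2) => //;
    exact: fcoupling_prod.
exists 0 => _ [w wc <-]; rewrite -(cost_cst 0 mr wc); exact: cost_le wc _.
Qed.

Section Metric.
Variables (r : seq A) (d : A -> A -> R).
Hypothesis d_pm : pseudometric1 d.

Let d0 x y : 0 <= d x y. Proof. by case: d_pm => /(_ x y)/andP[]. Qed.

Lemma kantorovich_le m n w : distr r m -> distr r n -> fcoupling r m n w ->
  kantorovich d m n <= cost r d w.
Proof.
move=> mr nr wc; rewrite (kantorovichE d mr nr); apply: ge_inf; last by exists w.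
exact: (has_inf_costs d0 mr nr).2.
Qed.

Lemma kantorovich_adherent m n (e : R) : distr r m -> distr r n -> 0 < e ->
  exists2 w, fcoupling r m n w & cost r d w < kantorovich d m n + e.
Proof.
move=> mr nr e0; rewrite (kantorovichE d mr nr).
by have [_ [w wc <-] ?] := inf_adherent e0 (has_inf_costs d0 mr nr); exists w.
Qed.

Lemma kantorovich_itv m n : distr r m -> distr r n -> 0 <= kantorovich d m n <= 1.
Proof.
move=> mr nr; have pc := fcoupling_prod mr nr; apply/andP; split.
  rewrite (kantorovichE d mr nr); apply: lb_le_inf.
    exact: (has_inf_costs d0 mr nr).1.
  by move=> _ [w wc <-]; rewrite -(cost_cst 0 mr wc); exact: cost_le wc _.
apply: le_trans (kantorovich_le mr nr pc) _; rewrite -[leRHS](cost_cst 1 mr pc).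
by apply: cost_le pc _ => x y; case: d_pm => /(_ x y)/andP[].
Qed.

Lemma kantorovichxx m : distr r m -> kantorovich d m m = 0.
Proof.
move=> mr; have [ur m0 mx m1] := mr; have [_ [dxx _]] := d_pm.
apply/le_anti; rewrite (andP (kantorovich_itv mr mr)).1 andbT.
pose w (p : A * A) := (p.1 == p.2)%:R * m p.1.
have sE x (f : A -> R) : (x \notin r -> f x = 0) ->
    \sum_(y <- r) (x == y)%:R * f y = f x.
  move=> fx; have [xr|xr] := boolP (x \in r).
    rewrite (bigD1_seq x)//= eqxx mul1r big1 ?addr0// => y yx.
    by rewrite eq_sym (negbTE yx) mul0r.
  rewrite fx// big_seq big1// => y yr; case: eqP => [xy|_]; last by rewrite mul0r.
  by rewrite xy yr in xr.
have wc : fcoupling r m m w.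
  split.
  - by move=> p; exact: mulr_ge0.
  - move=> x y; rewrite /w /=; case: eqP => [<-|_]; last by rewrite mul0r.
    by rewrite orbb => /mx ->; rewrite mulr0.
  - by move=> x; rewrite /w /= (sE x (fun=> m x)) => // /mx.
  - move=> y; rewrite -[RHS](sE y)//; last exact: mx.
    by apply: eq_bigr => x _; rewrite /w /= eq_sym.
apply: le_trans (kantorovich_le mr mr wc) _; rewrite /cost big1// => x _; rewrite big1// => y _.
by rewrite /w /=; case: eqP => [<-|_]; rewrite ?dxx mul0r// mulr0.
Qed.

Lemma fcoupling_sym m n w : fcoupling r m n w -> fcoupling r n m (fun p => w (p.2, p.1)).
Proof. by move=> [w0 wr wm wn]; split => // x y; rewrite orbC => /wr. Qed.

Lemma kantorovichC m n : distr r m -> distr r n -> kantorovich d m n = kantorovich d n m.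
Proof.
have [_ [_ [dC _]]] := d_pm.
suff le m' n' : distr r m' -> distr r n' -> kantorovich d m' n' <= kantorovich d n' m'.
  by move=> mr nr; apply/le_anti; rewrite !le.
move=> mr nr; rewrite (kantorovichE d nr mr); apply: lb_le_inf.
  exact: (has_inf_costs d0 nr mr).1.
move=> _ [w wc <-]; apply: le_trans (kantorovich_le mr nr (fcoupling_sym wc)) _.
rewrite /cost exchange_big /= le_eqVlt; apply/orP; left; apply/eqP.
by apply: eq_bigr => x _; apply: eq_bigr => y _; rewrite dC.
Qed.

Lemma fcoupling_eq0 m n w : distr r m -> fcoupling r m n w ->
  forall x y, m x = 0 -> w (x, y) = 0.
Proof.
move=> [ur _ _ _] [w0 wr wm _] x y mx0.
have [yr|yr] := boolP (y \in r); last by apply: wr; rewrite yr orbT.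
apply/le_anti; rewrite w0 andbT -mx0 -wm (bigD1_seq y)//= lerDl.
by apply: sumr_ge0.
Qed.

(* Couplings of [m], [n] and of [n], [k] are glued along [n]. *)
Lemma kantorovich_triang m n k : distr r m -> distr r n -> distr r k ->
  kantorovich d m k <= kantorovich d m n + kantorovich d n k.
Proof.
move=> mr nr kr; have [_ [_ [_ dT]]] := d_pm.
apply/ler_addgt0Pr => e e0; have e2 : 0 < e / 2 by rewrite divr_gt0.
have [w1 c1 h1] := kantorovich_adherent mr nr e2.
have [w2 c2 h2] := kantorovich_adherent nr kr e2.
have [p1 z1 m1 n1] := c1; have [p2 z2 m2 n2] := c2.
have [ur n0 _ _] := nr.
(* The two couplings are made independent conditionally on [y]. Where [n y = 0] the quotient is 0 by
   convention, and both couplings vanish there anyway. *)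
pose q x y z := w1 (x, y) * w2 (y, z) / n y.
have qz x y : \sum_(z <- r) q x y z = w1 (x, y).
  rewrite -mulr_suml -mulr_sumr m2; have [ny|ny] := eqVneq (n y) 0.
    by rewrite ny !mulr0 (fcoupling_eq0 nr (fcoupling_sym c1) _ ny (x := y)) ?mul0r.
  by rewrite mulfK.
have qx y z : \sum_(x <- r) q x y z = w2 (y, z).
  rewrite -!mulr_suml n1; have [ny|ny] := eqVneq (n y) 0.
    by rewrite ny !mul0r (fcoupling_eq0 nr c2 _ ny).
  by rewrite mulrAC mulfV// mul1r.
have q0 x y z : 0 <= q x y z by rewrite divr_ge0// mulr_ge0.
pose w (p : A * A) := \sum_(y <- r) q p.1 y p.2.
have wc : fcoupling r m k w.
  split.
  - by move=> p; apply: sumr_ge0.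
  - move=> x z /orP xz; apply: big1 => y _; rewrite /q /=; case: xz => [xr|zr].
      by rewrite z1 ?xr// !mul0r.
    by rewrite z2 ?zr ?orbT// mulr0 mul0r.
  - by move=> x; rewrite exchange_big -m1; apply: eq_bigr => y _; exact: qz.
  - by move=> z; rewrite exchange_big -n2; apply: eq_bigr => y _; exact: qx.
apply: le_trans (kantorovich_le mr kr wc) _.
suff : cost r d w <= cost r d w1 + cost r d w2.
  move=> /le_trans; apply; apply: le_trans (lerD (ltW h1) (ltW h2)) _.
  by rewrite addrACA -splitr.
have -> : cost r d w1 = \sum_(x <- r) \sum_(z <- r) \sum_(y <- r) d x y * q x y z.
  apply: eq_bigr => x _; rewrite exchange_big; apply: eq_bigr => y _ /=.
  by rewrite -mulr_sumr qz.
have -> : cost r d w2 = \sum_(x <- r) \sum_(z <- r) \sum_(y <- r) d y z * q x y z.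
  rewrite exchange_big [LHS]exchange_big; apply: eq_bigr => z _ /=.
  rewrite exchange_big; apply: eq_bigr => y _ /=.
  by rewrite -mulr_sumr qx.
rewrite -big_split; apply: ler_sum => x _; rewrite -big_split; apply: ler_sum => z _ /=.
rewrite mulr_sumr -big_split; apply: ler_sum => y _ /=.
by rewrite -mulrDl; apply: ler_wpM2r.
Qed.

End Metric.

Lemma kantorovich_mono r d d' m n : (forall x y, 0 <= d x y <= d' x y) ->
  distr r m -> distr r n -> kantorovich d m n <= kantorovich d' m n.
Proof.
move=> dd' mr nr; have d0 x y : 0 <= d x y by case/andP: (dd' x y).
have d'0 x y : 0 <= d' x y by case/andP: (dd' x y) => /le_trans h /h.
rewrite (kantorovichE d mr nr) (kantorovichE d' mr nr).
apply: lb_le_inf; first exact: (has_inf_costs d'0 mr nr).1.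
move=> _ [w wc <-]; apply: (@le_trans _ _ (cost r d w)); last first.
  by apply: cost_le wc _ => x y; case/andP: (dd' x y).
by apply: ge_inf; [exact: (has_inf_costs d0 mr nr).2|exists w].
Qed.

Lemma distr_mass (l : seq (R * A)) r : nonneg l -> tot l = 1 -> uniq r ->
  {subset [seq x.2 | x <- l] <= r} -> distr r (mass l).
Proof.
move=> l0 l1 ur lr.
have out x : x \notin r -> mass l x = 0.
  move=> xr; rewrite /mass /Ex big_seq big1// => -[p k] xl /=; case: eqP => [kx|_].
    by move: xr; rewrite -kx lr//; apply/mapP; exists (p, k).
  by rewrite mulr0.
split => // [x|]; first exact: mass_ge0.
by rewrite -l1 /tot (Ex_mass _ ur out l0); apply: eq_bigr => x _; rewrite mulr1.
Qed.

End Kantorovich.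

(** * Least fixed points among pseudometrics *)

Section LeastFixpoint.
Context {R : realType} {A : Type}.
Implicit Types d : A -> A -> R.

(** Pointwise infima of pseudometrics can violate the triangle inequality, while pointwise suprema
    preserve it. The least fixed point is thus obtained as the supremum of all pseudometrics lying
    below every prefixed point, not as the infimum of the prefixed points. *)
Lemma least_fixpoint (F : (A -> A -> R) -> A -> A -> R) :
  (forall d, pseudometric1 d -> pseudometric1 (F d)) ->
  (forall d d', pseudometric1 d -> pseudometric1 d' ->
    (forall x y, d x y <= d' x y) -> forall x y, F d x y <= F d' x y) ->
  exists g, [/\ pseudometric1 g, F g = g &
    forall d, pseudometric1 d -> F d = d -> forall x y, g x y <= d x y].
Proof.
move=> Fpm Fmono.
pose P d := pseudometric1 d /\ forall x y, F d x y <= d x y.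
pose Q d := pseudometric1 d /\ forall p, P p -> forall x y, d x y <= p x y.
have Q0 : Q (fun _ _ => 0).
  split; last by move=> p [[p01 _] _] x y; case/andP: (p01 x y).
  by split; [move=> x y; rewrite lexx ler01|split => //; split => // x y z; rewrite addr0].
pose S x y : set R := [set d x y | d in Q].
have S1 x y : ubound (S x y) 1 by move=> _ [d [[d01 _] _] <-]; case/andP: (d01 x y).
have S0 x y : S x y !=set0 by exists 0, (fun _ _ => 0).
pose g x y := sup (S x y).
have gge d x y : Q d -> d x y <= g x y.
  by move=> Qd; apply: ub_le_sup; [exists 1; exact: S1|exists d].
have gle x y c : ubound (S x y) c -> g x y <= c by move=> h; exact: ge_sup.
have gpm : pseudometric1 g.
  split; [|split; [|split]].
  - by move=> x y; rewrite (gge _ _ _ Q0)/=; apply: gle; exact: S1.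
  - move=> x; apply/le_anti; rewrite (gge _ _ _ Q0) andbT; apply: gle.
    by move=> _ [d [[_ [dxx _]] _] <-]; rewrite dxx.
  - move=> x y; congr sup; apply/seteqP; split => _ [d Qd <-]; exists d => //.
      by case: Qd => -[_ [_ [dC _]]] _.
    by case: Qd => -[_ [_ [dC _]]] _.
  - move=> x y z; apply: gle => _ [d Qd <-].
    have [[_ [_ [_ dT]]] _] := Qd; apply: le_trans (dT x y z) _.
    by apply: lerD; exact: gge.
have gP p : P p -> forall x y, g x y <= p x y.
  by move=> Pp x y; apply: gle => _ [d [_ dP] <-]; exact: dP.
have Fg : Q (F g).
  split; first exact: Fpm.
  move=> p [ppm Fp] x y; apply: le_trans (Fp x y).
  by apply: Fmono => //; exact: gP.
have Fgg x y : F g x y <= g x y by exact: gge.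
have PFg : P (F g) by split; [exact: Fpm|apply: Fmono => //; exact: Fpm].
exists g; split => //.
  by apply/funext => x; apply/funext => y; apply/le_anti; rewrite Fgg gP.
by move=> d dpm Fd; apply: gP; split => // x y; rewrite Fd.
Qed.

End LeastFixpoint.

(** * The label-wise lifting and the fixed point equation of the discounted distance *)

Section DiscountedDistance.
Context {R : realType} {L N : choiceType} {lambda : R}.
Hypothesis infN : infinite_set [set: N].
Hypotheses (l0 : 0 <= lambda) (l1 : lambda <= 1).
Local Notation tm := (term R L void N).
Implicit Types d : tm -> tm -> R.

(** The closed form of the greatest lifting: away from pairs with a common label, only the zero
    diagonal and the bound 1 constrain it. *)
Definition lift_dist d (x y : option (succ R L N)) : R :=
  match x, y with
  | Some (inl (a, t)), Some (inl (b, s)) => if a == b then lambda * d t s else 1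
  | _, _ => (x != y)%:R
  end.

(** Distinct points are closer than 1 only if their labels agree. So in a nondegenerate triangle
    either one leg is already 1, or all three points carry one label and the inequality for [d] is
    scaled. *)
Lemma lift_dist_pm d : pseudometric1 d -> pseudometric1 (lift_dist d).
Proof.
move=> [d01 [dxx [dC dT]]].
have ld01 t s : 0 <= lambda * d t s <= 1.
  have /andP[h0 h1] := d01 t s; rewrite mulr_ge0//=.
  by rewrite -[leRHS]mulr1 ler_pM.
have b01 (b : bool) : 0 <= (b%:R : R) <= 1 by case: b; rewrite ?lexx ?ler01.
have lift01 x y : 0 <= lift_dist d x y <= 1.
  case: x y => [[[a t]|X]|] [[[b s]|Y]|]; rewrite ?b01//=.
  by case: eqP => // _; rewrite lexx ler01.
have lift_dist_ge0 x y : 0 <= lift_dist d x y by case/andP: (lift01 x y).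
have ldC x y : lift_dist d x y = lift_dist d y x.
  case: x y => [[[a t]|X]|] [[[b s]|Y]|] //=; rewrite 1?eq_sym//.
  by rewrite dC.
split => //; split; [|split => //].
  by move=> [[[a t]|X]|] /=; rewrite ?eqxx// dxx mulr0.
have one x y : x != y -> lift_dist d x y = 1 \/ exists a t s, x = Some (inl (a, t)) /\ y = Some (inl (a, s)).
  case: x y => [[[a t]|X]|] [[[b s]|Y]|] //=; try by [left|move=> ->; left].
  by have [<-|ab] := eqVneq a b; [right; exists a, t, s|left].
move=> x y z.
have [->|xz] := eqVneq x z.
  by rewrite (_ : lift_dist d z z = 0) ?addr_ge0//; case: z => [[[a t]|X]|] /=; rewrite ?eqxx// dxx mulr0.
have [->|xy] := eqVneq x y; first by rewrite lerDr.
have [->|yz] := eqVneq y z; first by rewrite lerDl.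
have [->|[a [t [s [xE yE]]]]] := one _ _ xy.
  by rewrite -[leLHS]addr0 lerD//; case/andP: (lift01 x z).
have [->|[b [t' [s' [yE' zE]]]]] := one _ _ yz.
  by rewrite -[leLHS]add0r lerD//; case/andP: (lift01 x z).
have [ba ts] : b = a /\ t' = s by move: yE; rewrite yE' => -[-> ->].
clear yE'; subst b t' x y z.
by rewrite /lift_dist eqxx -mulrDr ler_wpM2l.
Qed.

Lemma LamE d : pseudometric1 d -> Lam lambda d = lift_dist d.
Proof.
move=> dpm; have lpm := lift_dist_pm dpm.
have Pl : [set D | pseudometric1 D /\ forall a t s,
    D (Some (inl (a, t))) (Some (inl (a, s))) = lambda * d t s] (lift_dist d).
  by split => // a t s; rewrite /lift_dist eqxx.
rewrite /Lam /greatest_fun; case: xgetP => [h _ [[hpm hE] hP]|/(_ (lift_dist d))]; last first.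
  case; split => // D [[D01 [Dxx _]] DE] x y.
  have D1 : D x y <= 1 by case/andP: (D01 x y).
  have Dn : D x y <= (x != y)%:R by case: eqP => // ->; rewrite Dxx.
  move: D1 Dn; case: x y => [[[a t]|X]|] [[[b s]|Y]|] //= D1 Dn.
  by case: eqP => // <-; rewrite DE.
apply/funext => x; apply/funext => y; apply/le_anti; rewrite (hP _ Pl) andbT.
have [h01 [hxx _]] := hpm.
have h1 : h x y <= 1 by case/andP: (h01 x y).
have hn : h x y <= (x != y)%:R by case: eqP => // ->; rewrite hxx.
move: h1 hn; case: x y => [[[a t]|X]|] [[[b s]|Y]|] //= h1 hn.
by case: eqP => // <-; rewrite hE.
Qed.

Lemma lift_dist_mono d d' : (forall t s, d t s <= d' t s) -> forall x y, lift_dist d x y <= lift_dist d' x y.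
Proof.
move=> dd' [[[a t]|X]|] [[[b s]|Y]|] //=; case: eqP => // _.
exact: ler_wpM2l.
Qed.

Lemma star_chain (t : tm) : star (universal_chain t) = mass (full t).
Proof.
rewrite universal_chainE//; apply/funext => -[x|]; rewrite /mass Ex_full /=.
  by rewrite mulr0 addr0; apply: Ex_ext => j.
rewrite mulr1 (_ : Ex _ _ = 0) ?add0r; last first.
  rewrite -[RHS](mul0r (tot (trans t))) -ExZ; apply: Ex_ext => j; by rewrite mul0r.
have tn := trans_nonneg t; pose r := undup [seq x.2 | x <- trans t].
have out x : x \notin r -> mass (trans t) x = 0.
  move=> xr; rewrite /mass /Ex big_seq big1// => -[p k] xl /=; case: eqP => [kx|_].
    by move: xr; rewrite mem_undup -kx => /mapP[]; exists (p, k).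
  by rewrite mulr0.
rewrite (fsumE (undup_uniq _) out) /tot (Ex_mass _ (undup_uniq _) out tn).
by congr (1 - _); apply: eq_bigr => x _; rewrite mulr1.
Qed.

Definition keys (A : seq tm) : seq (option (succ R L N)) :=
  undup (flatten [seq [seq x.2 | x <- full t] | t <- A]).

Lemma distr_full A t : t \in A -> distr (keys A) (mass (full t)).
Proof.
move=> tA; apply: distr_mass; rewrite ?full_nonneg ?tot_full ?undup_uniq//.
by move=> k kt; rewrite mem_undup; apply/flatten_mapP; exists t.
Qed.

Lemma PsiE d t s : pseudometric1 d ->
  Psi lambda d t s = kantorovich (lift_dist d) (mass (full t)) (mass (full s)).
Proof. by move=> dpm; rewrite /Psi LamE// !star_chain. Qed.

Lemma Psi_pm d : pseudometric1 d -> pseudometric1 (Psi lambda d).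
Proof.
move=> dpm; have lpm := lift_dist_pm dpm.
split; [|split; [|split]] => [t s|t|t s|t s u]; rewrite !PsiE//.
- by apply: (@kantorovich_itv _ _ (keys [:: t; s])) => //; apply: distr_full; rewrite !inE ?eqxx ?orbT.
- by apply: (@kantorovichxx _ _ (keys [:: t])) => //; apply: distr_full; rewrite !inE ?eqxx ?orbT.
- by apply: (@kantorovichC _ _ (keys [:: t; s])) => //; apply: distr_full; rewrite !inE ?eqxx ?orbT.
- by apply: (@kantorovich_triang _ _ (keys [:: t; s; u])) => //; apply: distr_full;
    rewrite !inE ?eqxx ?orbT.
Qed.

Lemma Psi_mono d d' : pseudometric1 d -> pseudometric1 d' ->
  (forall t s, d t s <= d' t s) -> forall t s, Psi lambda d t s <= Psi lambda d' t s.
Proof.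
move=> dpm d'pm dd' t s; rewrite !PsiE//.
apply: (@kantorovich_mono _ _ (keys [:: t; s])) => [x y||];
  try by apply: distr_full; rewrite !inE ?eqxx ?orbT.
by rewrite lift_dist_mono// andbT; have [/(_ x y)/andP[]] := lift_dist_pm dpm.
Qed.

Lemma discounted_dist_fixpoint :
  pseudometric1 (@discounted_dist R L N lambda) /\
  Psi lambda (@discounted_dist R L N lambda) = @discounted_dist R L N lambda.
Proof.
have [g [gpm gfix gmin]] := least_fixpoint Psi_pm Psi_mono.
rewrite /discounted_dist (@least_funP _ _ _ _ g)//.
by move=> d [dpm dfix]; exact: gmin.
Qed.

End DiscountedDistance.

(** * Completeness *)

Section Completeness.
Context {R : realType} {L W N : choiceType} {lambda : R}.
Hypothesis infN : infinite_set [set: N].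
Hypotheses (l0 : 0 <= lambda) (l1 : lambda <= 1).
Local Notation tm := (term R L void N).
Local Notation key := (option (succ R L N)).
Local Notation d := (@discounted_dist R L N lambda).
Local Notation pdist := (@dist R L W N lambda).
Local Notation eqv := (@eqv R L W N lambda).
Local Notation lam := (@lift_dist R L N lambda).

Let D (t s : tm) : R := pdist (embed W t) (embed W s).

Lemma dist_interp (x y : key) : pdist (interp x) (interp y) <= lam D x y.
Proof.
have le1 (k j : key) : pdist (interp k) (interp j) <= (k != j)%:R.
  by have [->|_] := eqVneq k j; [rewrite distxx|exact: dist_le1].
case: x y => [[[a t]|X]|] [[[b s]|Y]|]; try exact: le1.
by rewrite /lift_dist; case: eqP => [<-|_]; [exact: dist_Pre|exact: dist_le1].
Qed.

(** A coupling is read as a list of weighted pairs. By its marginals, both terms are provably convex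
    combinations over this same list, along first and second components, and can be compared summand
    by summand. *)
Lemma dist_le_cost r t s w : distr r (mass (full t)) -> distr r (mass (full s)) ->
  fcoupling r (mass (full t)) (mass (full s)) w -> D t s <= cost r (lam D) w.
Proof.
move=> tr sr [w0 wr wt ws]; have [_ _ _ t1] := tr.
pose l := [seq (w p, p) | p <- [seq (x, y) | x <- r, y <- r]].
have ExE phi : Ex l phi = cost r (fun x y => phi (x, y)) w.
  rewrite /Ex big_map sum_allpairs; apply: eq_bigr => x _; apply: eq_bigr => y _.
  exact: mulrC.
have ln : nonneg l by apply/allP => _ /mapP[p _ ->]; exact: w0.
have ltot : tot l = 1.
  by rewrite /tot ExE -[RHS]t1; apply: eq_bigr => x _; rewrite -wt; apply: eq_bigr => y _;
    rewrite mul1r.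
have massE u (g : key * key -> key) : (forall k, mass (push 1 g l) k = mass (full u) k) ->
    eqv (embed W u) (csum (interp \o g) l).
  move=> mE; apply: eqv_trans (expansion infN u) _.
  rewrite -(csum_push (c := 1))//; apply: csum_mass; rewrite ?full_nonneg ?nonneg_push//.
  by rewrite tot_full.
have sumE k (f : key -> R) : (k \notin r -> f k = 0) -> uniq r ->
    \sum_(x <- r) (x == k)%:R * f x = f k.
  move=> fk ur; have [kr|kr] := boolP (k \in r).
    rewrite (bigD1_seq k)//= eqxx mul1r big1 ?addr0// => x xk.
    by rewrite (negbTE xk) mul0r.
  rewrite fk// big_seq big1// => x xr; case: eqP => [xk|_]; last by rewrite mul0r.
  by rewrite -xk xr in kr.
have [ur _ _ _] := tr.
have tE : eqv (embed W t) (csum (interp \o fst) l).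
  apply: massE => k; rewrite {1}/mass Ex_push mul1r ExE -[RHS](sumE k (mass (full t)))//; last by case: tr => _ _ + _; exact.
  by apply: eq_bigr => x _; rewrite -mulr_sumr wt.
have sE : eqv (embed W s) (csum (interp \o snd) l).
  apply: massE => k; rewrite {1}/mass Ex_push mul1r ExE -[RHS](sumE k (mass (full s)))//; last by case: sr => _ _ + _; exact.
  rewrite /cost exchange_big; apply: eq_bigr => x _ /=.
  by rewrite -mulr_sumr ws.
rewrite /D (dist_eqv tE sE) -[leLHS]mul1r -ltot.
apply: le_trans (csum_dist _ _ ln) _; rewrite -[leRHS](ExE (fun p => lam D p.1 p.2)).
by apply: Ex_le => // -[x y]; exact: dist_interp.
Qed.

Lemma max_gap (T : Type) (s : seq T) (f : T -> R) :
  (forall x, List.In x s -> f x <= 0) \/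
  exists m m', [/\ 0 <= m', m' < m, exists2 x, List.In x s & f x = m &
    forall x, List.In x s -> f x = m \/ f x <= m'].
Proof.
elim: s => [|y s [s0|[m [m' [m'0 mm' [x xs fx] sm]]]]]; first by left.
  have [y0|y0] := leP (f y) 0; first by left=> x /= [<-//|/s0].
  right; exists (f y), 0; split=> //; first by exists y => //; left.
  by move=> x /= [<-|/s0]; [left|right].
right; have [ym|my|ym] := ltgtP (f y) m.
- exists m, (Num.max m' (f y)); split; rewrite ?le_max ?m'0 ?gt_max ?mm'//.
    by exists x => //; right.
  move=> z /= [<-|/sm[->|zm']]; rewrite ?le_max ?lexx ?orbT; [by right|by left|].
  by right; rewrite zm'.
- exists (f y), m; split => //; first by rewrite ltW// (le_lt_trans m'0).
    by exists y => //; left.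
  move=> z /= [<-|/sm[->|zm']]; [by left|by right|right].
  by rewrite (le_trans zm')// ltW.
- exists m, m'; split => //; first by exists x => //; right.
  by move=> z /= [<-|/sm]; [left|].
Qed.

(** * Pairs of maximal gap *)

Section Gap.
Variables (A : seq tm) (m m' : R).
Hypotheses (clA : closed_terms A) (m'0 : 0 <= m') (mm' : m' < m).
Hypothesis gap : forall t s, t \in A -> s \in A ->
  D t s - d t s = m \/ D t s - d t s <= m'.

Definition extremal (t s : tm) := [/\ t \in A, s \in A & D t s - d t s = m].

Definition lift_extremal (x y : key) : Prop :=
  match x, y with
  | Some (inl (a, t)), Some (inl (b, s)) => a = b /\ extremal t s
  | _, _ => False
  end.

Let off (x y : key) : R := (~~ `[< lift_extremal x y >])%:R.

Lemma mass_outside t a u : t \in A -> u \notin A -> mass (full t) (Some (inl (a, u))) = 0.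
Proof.
move=> tA uA; rewrite /mass Ex_full /= mulr0 addr0.
apply: Ex_eq0 (trans_nonneg t) (outside_ge0 A) (clA ((In_mem _ _).2 tA)) _.
move=> [[b v]|X] //=; case: asboolP => [/In_mem vA _|_ /eqP]; last by rewrite oner_eq0.
by case: eqP => // -[_ vu]; rewrite -vu vA in uA.
Qed.

(** The added term is [m] on pairs lifted from extremal ones and [m'] elsewhere; both are
    nonnegative, so the factor [lambda <= 1] on gaps at a common label does no harm. *)
Lemma lift_dist_gap x y : (forall a u, x = Some (inl (a, u)) -> u \in A) ->
  (forall a u, y = Some (inl (a, u)) -> u \in A) ->
  lam D x y <= lam d x y + (m - (m - m') * off x y).
Proof.
have out z : ~ lift_extremal x y -> z <= z + (m - (m - m') * off x y).
  by move=> nl; rewrite /off; case: asboolP => // _; rewrite mulr1 subKr lerDl.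
move=> xA yA; case: x y xA yA out => [[[a u]|X]|] [[[b v]|Y]|] xA yA out;
  try exact: out.
have uA := xA _ _ erefl; have vA := yA _ _ erefl.
rewrite /lift_dist; case: eqP => [ab|nab]; last by apply: out => -[].
rewrite -lerBlDl -mulrBr /off; case: asboolP => /= [[_ [_ _ ->]]|nM].
  by rewrite mulr0 subr0 ler_piMl// ltW// (le_lt_trans m'0).
rewrite mulr1 subKr; have [Duv|Duv] := gap uA vA; first by case: nM.
by apply: le_trans (ler_wpM2l l0 Duv) _; rewrite ler_piMl.
Qed.

Lemma small_off t s (e : R) : extremal t s -> 0 < e ->
  exists2 w, fcoupling (keys A) (mass (full t)) (mass (full s)) w &
    cost (keys A) off w <= e.
Proof.
move=> [tA sA Dm] e0; have [dpm dfix] := @discounted_dist_fixpoint R L N lambda infN l0 l1.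
have tr := distr_full tA; have sr := distr_full sA.
have mm'0 : 0 < m - m' by rewrite subr_gt0.
have [w wc wd] := kantorovich_adherent (lift_dist_pm l0 l1 dpm) tr sr (mulr_gt0 e0 mm'0).
exists w => //; rewrite -PsiE// dfix in wd.
have le : cost (keys A) (lam D) w <=
    cost (keys A) (fun x y => lam d x y + (m - (m - m') * off x y)) w.
  apply: ler_sum => x _; apply: ler_sum => y _.
  (* [lift_dist_gap] requires targets in [A]; at a pair with another target one marginal is 0, hence
     so is the weight. *)
  have [->|wxy] := eqVneq (w (x, y)) 0; first by rewrite !mulr0.
  have [w0 _ _ _] := wc; apply: ler_wpM2r => //; apply: lift_dist_gap => a u xE.
    apply: contraNT wxy => uA; rewrite (fcoupling_eq0 tr wc)//.
    by rewrite xE mass_outside.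
  apply: contraNT wxy => uA; have := fcoupling_eq0 sr (fcoupling_sym wc) (x := y) x.
  by move=> ->//; rewrite xE mass_outside.
have costE' : cost (keys A) (fun x y => lam d x y + (m - (m - m') * off x y)) w =
    cost (keys A) (lam d) w + (m - (m - m') * cost (keys A) off w).
  rewrite -[X in _ = _ + (X - _)](cost_cst m tr wc) /cost mulr_sumr -sumrB -big_split.
  apply: eq_bigr => x _; rewrite /= mulr_sumr -sumrB -big_split.
  by apply: eq_bigr => y _ /=; ring.
have := dist_le_cost tr sr wc; rewrite -/(D t s) => Dle.
rewrite -(ler_pM2r mm'0) mulrC; move: le; rewrite costE' => le; lra.
Qed.

(** Every coupling computes both integrals through its marginals, and the integrands agree except on
    pairs counted by [off], to which [small_off] gives arbitrarily small mass. *)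
Lemma lift_extremal_Ex t s (psi : key -> R) : (forall x y, lift_extremal x y -> psi x = psi y) ->
  extremal t s -> Ex (full t) psi = Ex (full s) psi.
Proof.
move=> inv Mts; have [tA sA _] := Mts.
have tr := distr_full tA; have sr := distr_full sA.
have [ur t0 tn t1] := tr; have [_ s0 sn s1] := sr.
(* [B] bounds [2 * |psi|] on the keys, hence every difference of two values of [psi]; the summand 1
   makes it positive, so that [e / B] is an admissible error. *)
pose B := 1 + \sum_(x <- keys A) 2 * `|psi x|.
have B0 : 0 < B by apply: ltr_pwDl => //; apply: sumr_ge0 => x _; rewrite mulr_ge0.
have psiB x : x \in keys A -> 2 * `|psi x| <= B.
  move=> xA; rewrite /B (bigD1_seq x)//= addrCA lerDl addr_ge0//.
  by apply: sumr_ge0 => y _; rewrite mulr_ge0.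
have diff x y : x \in keys A -> y \in keys A ->
    psi x <= psi y + B * off x y /\ psi y <= psi x + B * off x y.
  move=> xA yA; rewrite /off; case: asboolP => /= [/inv ->|_]; first by rewrite mulr0 addr0.
  rewrite mulr1; have := psiB _ xA; have := psiB _ yA.
  have := ler_norm (psi x); have := ler_norm (psi y).
  have := ler_norm (- psi x); have := ler_norm (- psi y); rewrite !normrN.
  by split; lra.
have ExtE w : fcoupling (keys A) (mass (full t)) (mass (full s)) w ->
    Ex (full t) psi = cost (keys A) (fun x _ => psi x) w.
  move=> [_ _ wt _]; rewrite (Ex_mass _ ur tn) ?full_nonneg//.
  by apply: eq_bigr => x _; rewrite -wt mulr_suml; apply: eq_bigr => y _; rewrite mulrC.
have ExsE w : fcoupling (keys A) (mass (full t)) (mass (full s)) w ->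
    Ex (full s) psi = cost (keys A) (fun _ y => psi y) w.
  move=> [_ _ _ ws]; rewrite (Ex_mass _ ur sn) ?full_nonneg// /cost exchange_big.
  by apply: eq_bigr => x _; rewrite -ws mulr_suml; apply: eq_bigr => y _; rewrite mulrC.
have costD w (f : key -> key -> R) : cost (keys A) (fun x y => f x y + B * off x y) w =
    cost (keys A) f w + B * cost (keys A) off w.
  rewrite /cost mulr_sumr -big_split; apply: eq_bigr => x _ /=.
  by rewrite mulr_sumr -big_split; apply: eq_bigr => y _ /=; ring.
have costle w (f g : key -> key -> R) : (forall p, 0 <= w p) ->
    (forall x y, x \in keys A -> y \in keys A -> f x y <= g x y) ->
    cost (keys A) f w <= cost (keys A) g w.
  move=> w0 fg; rewrite /cost big_seq [leRHS]big_seq; apply: ler_sum => x xA.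
  rewrite big_seq [leRHS]big_seq; apply: ler_sum => y yA.
  by apply: ler_wpM2r => //; exact: fg.
have step w e (f g : key -> key -> R) : (forall p, 0 <= w p) -> cost (keys A) off w <= e / B ->
    (forall x y, x \in keys A -> y \in keys A -> f x y <= g x y + B * off x y) ->
    cost (keys A) f w <= cost (keys A) g w + e.
  move=> w0 we fg; apply: le_trans (costle _ _ _ w0 fg) _.
  by rewrite costD lerD2l mulrC -ler_pdivlMr.
apply/le_anti/andP; split; apply/ler_addgt0Pr => e e0;
  have [w wc we] := small_off Mts (divr_gt0 e0 B0); have [w0 _ _ _] := wc;
  rewrite (ExtE _ wc) (ExsE _ wc); apply: step w0 we _ => x y xA yA.
- exact: (diff _ _ xA yA).1.
- exact: (diff _ _ xA yA).2.
Qed.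

(* The invariant predicates of [extremal] define the equivalence relation it generates,
   which is a bisimulation by [lift_extremal_Ex]. *)
Definition extremal_equiv (t s : tm) := forall Q : tm -> Prop,
  (forall u v, extremal u v -> (Q u <-> Q v)) -> (Q t <-> Q s).

Lemma extremal_eqv t s : extremal t s -> eqv (embed W t) (embed W s).
Proof.
move=> Mts; have [tA sA _] := Mts.
(* The first element of [A] equivalent to [u]. It depends only on the class of [u], so equivalent
   terms get equal representatives. *)
pose r u := nth t A (find (fun v => `[< extremal_equiv u v >]) A).
have hasr u : u \in A -> has (fun v => `[< extremal_equiv u v >]) A.
  by move=> uA; apply/hasP; exists u => //; apply/asboolP => Q _.
have rA u : u \in A -> r u \in A by move=> /hasr hu; rewrite mem_nth// -has_find.
have Mr u : u \in A -> extremal_equiv u (r u) by move=> /hasr /(nth_find t) /asboolP.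
have Meq_r u v : extremal_equiv u v -> r u = r v.
  move=> uv; congr nth; apply: eq_find => x; apply/asboolP/asboolP => h Q hQ.
    by rewrite -(h Q hQ) (uv Q hQ).
  by rewrite -(h Q hQ) (uv Q hQ).
have rr u : u \in A -> r (r u) = r u by move=> uA; exact: esym (Meq_r _ _ (Mr _ uA)).
have M_r u v : extremal u v -> r u = r v by move=> Muv; apply: Meq_r => Q; exact.
suff rE u : u \in A -> eqv (embed W u) (embed W (r u)).
  by apply: eqv_trans (rE _ tA) _; rewrite (M_r _ _ Mts); apply/eqv_sym/rE.
move: u; apply: bisimilar_eqv => // u uA phi; set Phi := branch _ _.
(* The equivalence of [u] and [r u] is applied to the predicate of having the same integral as [u];
   it then suffices to compare the two ends of one extremal pair. *)
apply/esym; have := Mr _ uA (fun v => Ex (trans v) Phi = Ex (trans u) Phi).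
case=> [v v' Mv|h _]; last exact: h.
suff -> : Ex (trans v) Phi = Ex (trans v') Phi by [].
have fullE x : Ex (trans x) Phi = Ex (full x) (fun k => if k is Some y then Phi y else 0).
  by rewrite Ex_full mulr0 addr0.
rewrite !fullE; apply: lift_extremal_Ex Mv => -[[[a x]|X]|] [[[b y]|Y]|] //= [-> /M_r].
by rewrite /Phi /= => ->.
Qed.

End Gap.

(** [A] must be closed under transitions, so that couplings between its terms only weigh successor
    pairs on which the maximality of [m] is known. *)
Lemma provable_dist_le t s : D t s <= d t s.
Proof.
pose A := derivatives t ++ derivatives s.
have tA : t \in A by apply/In_mem/List.in_app_iff; left; exact: In_derivatives.
have sA : s \in A by apply/In_mem/List.in_app_iff; right; exact: In_derivatives.
have clA : closed_terms A.
  move=> u /List.in_app_iff[] /derivatives_closed; apply: outside_sub => v vA;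
    apply/List.in_app_iff; by [left|right].
have [dpm _] := @discounted_dist_fixpoint R L N lambda infN l0 l1.
have [h|[m [m' [m'0 mm' [[u v] uvA uvm] gap]]]] :=
    max_gap [seq (x, y) | x <- A, y <- A] (fun p => D p.1 p.2 - d p.1 p.2).
  by rewrite -subr_le0; apply: (h (t, s)); apply/In_mem; exact: allpairs_f.
have [uA vA] : u \in A /\ v \in A.
  by have /allpairsP[[x y] /= [xA yA [-> ->]]] := (In_mem _ _).1 uvA.
have gapA x y : x \in A -> y \in A -> D x y - d x y = m \/ D x y - d x y <= m'.
  by move=> xA yA; apply: (gap (x, y)); apply/In_mem; exact: allpairs_f.
have Muv : extremal A m u v by [].
have := extremal_eqv clA m'0 mm' gapA Muv; rewrite -dist_eq0 -/(D u v) => Duv.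
have [/(_ u v)/andP[d0 _] _] := dpm.
have := le_lt_trans m'0 mm'; rewrite -uvm /= Duv sub0r oppr_gt0.
by rewrite ltNge d0.
Qed.

End Completeness.

Theorem theorem6p4 (R : realType) (L N W : countType)
    (infinite_names : infinite_set [set: N])
    (lambda : R) (lambda_gt0 : 0 < lambda) (lambda_le1 : lambda <= 1)
    (t s : term R L void N) (eps : {nonneg rat}) :
  discounted_dist lambda t s <= ratr eps%:num ->
  @derivable R L W N lambda set0 (embed W t ≡[eps] embed W s).
Proof.
move=> dts; apply: dist_prov_le; apply: le_trans dts.
exact: provable_dist_le (ltW lambda_gt0) lambda_le1 t s.
Qed.
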